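(* Let $\nu$ be a Lévy measure on $\mathbb{R}^m$ with $\int(|x|\wedge1)\,\nu(dx)<\infty$, let $Z$ be the associated Lévy process (with summable jumps), and let $t>0$, $s>0$. Let $(T_t(Z))_s$ be the transform of $Z$ in which every jump $x$ occurring before time $s$ is replaced, independently of the others, by $X_t^x$, where $$X_t^x=x+\sum_{j=1}^d A_j(x)\,B_t^j+\int_0^t B(X_v^x,x)\,dv .$$ Suppose that the Lévy measure $\nu$ is infinite. If the vectors $A_j(x)\in\mathbb{R}^m$ are such that for any infinite sequence $(x_n)_{n\in\mathbb{N}}$ in $\mathbb{R}^m$ with $x_n\neq0$ and $x_n\to0$, the vector space spanned by the vectors $$A_j(x_n),\qquad j=1,\ldots,d,\quad n\in\mathbb{N},$$ is $m$-dimensional, then $(T_t(Z))_s$ has a density with respect to Lebesgue measure on $\mathbb{R}^m$.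
   Context: Here $(B^1,\ldots,B^d)$ is a standard $d$-dimensional Brownian motion, defined on the Wiener space $(Y,\mathcal{Y},\mu)$ ($\mu$ the Wiener measure); $A_j:\mathbb{R}^m\to\mathbb{R}^m$, and $B:\mathbb{R}^m\times\mathbb{R}^m\to\mathbb{R}^m$ is $\mathcal{C}^1$ and Lipschitz with respect to its first argument. For $y\in Y$, $X_t^x(y)$ denotes the value of the solution driven by the Brownian path $y$. Let $\Pi_{t,x}$ be the law of $X_t^x$ and $\nu\Pi_t=\int\nu(dx)\,\Pi_{t,x}$. Let $M$ be the Poisson random measure on $\mathbb{R}_+\times\mathbb{R}^m$ of jumps of $Z$, with intensity $du\times\nu$, and let $N=M\odot\mu$ be $M$ marked by $\mu$: if $M=\sum_\alpha\varepsilon_{(s_\alpha,x_\alpha)}$ (sum of Dirac masses), then $N=\sum_\alpha\varepsilon_{(s_\alpha,x_\alpha,y_\alpha)}$ with marks $y_\alpha$ i.i.d. with law $\mu$ and independent of $M$. The transformed process is $$(T_t(Z))_s=\int_{[0,s]\times\mathbb{R}^m\times Y}X_t^x(y)\,N(du\,dx\,dy)=\sum_{s_\alpha\le s}X_t^{x_\alpha}(y_\alpha).$$ It is assumed that $\nu\Pi_t$ is well defined and that $\int(|\xi|\wedge1)\,\nu\Pi_t(d\xi)<\infty$, so that this sum converges absolutely almost surely and $s\mapsto(T_t(Z))_s$ is a Lévy process with Lévy measure $\nu\Pi_t$. *)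

(* Defs.v *)
From HB Require Import structures.
From mathcomp Require Import all_boot all_order all_algebra.
From mathcomp Require Import all_classical all_reals all_analysis.
From mathcomp Require Import measurable_realfun.

Set Implicit Arguments.
Unset Strict Implicit.
Unset Printing Implicit Defensive.

Import Order.TTheory GRing.Theory Num.Def Num.Theory.
Import numFieldNormedType.Exports.

Local Open Scope classical_set_scope.
Local Open Scope ring_scope.

Definition rV_display : measure_display. Proof. exact. Qed.

(* R^m carries the sigma-algebra generated by its coordinates, i.e. the Borel
   one. This is the analogue of the library's structure on [n.-tuple T]. *)
Section measurable_rV.
Context {R : realType} {m : nat}.

Definition rV_coord (i : 'I_m) (x : 'rV[R]_m) : R := x ord0 i.

Let rV_set0 : g_sigma_preimage rV_coord set0.
Proof. exact: sigma_algebra0. Qed.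

Let rV_setC A : g_sigma_preimage rV_coord A -> g_sigma_preimage rV_coord (~` A).
Proof. exact: sigma_algebraC. Qed.

Let rV_bigcup (F : (set 'rV[R]_m)^nat) :
  (forall i, g_sigma_preimage rV_coord (F i)) ->
  g_sigma_preimage rV_coord (\bigcup_i F i).
Proof. exact: sigma_algebra_bigcup. Qed.

HB.instance Definition _ := @isMeasurable.Build rV_display
  'rV[R]_m (g_sigma_preimage rV_coord) rV_set0 rV_setC rV_bigcup.

End measurable_rV.

Lemma measurable_rV_coord {R : realType} m (i : 'I_m) :
  measurable_fun [set: 'rV[R]_m] (rV_coord i).
Proof.
move=> _ Y mY; rewrite setTI; apply: sub_sigma_algebra => /=.
rewrite -bigcup_seq/=; exists i => /=; first by rewrite mem_index_enum.
by exists Y => //; rewrite setTI.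
Qed.

Lemma measurable_fun_rVP {R : realType} d (T : measurableType d) m
    (f : T -> 'rV[R]_m) :
  measurable_fun setT f <->
  forall i, measurable_fun setT (fun x => f x ord0 i).
Proof.
split=> [mf i|mf].
  exact: (measurableT_comp (measurable_rV_coord i) mf).
have subm : g_sigma_preimage (fun i => rV_coord i \o f) `<=` measurable.
  apply: smallest_sub; first exact: sigma_algebra_measurable.
  rewrite -bigcup_seq; apply: bigcup_sub => i _ A [B mB <-].
  exact: mf.
rewrite g_sigma_preimage_comp in subm.
by move=> _ A mA; apply: subm; exists A.
Qed.

Section lebesgue_rV.
Context {R : realType}.

Definition rV_cons m (p : measurableTypeR R * 'rV[R]_m) : 'rV[R]_m.+1 :=
  row_mx (const_mx p.1 : 'rV_1) p.2.

Definition rV_uncons m (x : 'rV[R]_m.+1) : measurableTypeR R * 'rV[R]_m :=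
  (x ord0 ord0, rsubmx (x : 'rV_(1 + m))).

(* Lebesgue measure on R^m: the m-fold product of Lebesgue measure on R. *)
Fixpoint lebesgue_rV m : set 'rV[R]_m -> \bar R :=
  match m with
  | 0 => dirac (0 : 'rV[R]_0)
  | m'.+1 => pushforward (lebesgue_measure \x @lebesgue_rV m')%E (@rV_cons m')
  end.

Lemma measurable_rV_cons m : measurable_fun setT (@rV_cons m).
Proof.
apply/measurable_fun_rVP => i; rewrite /rV_cons.
have [j ->|j ->] := split_ordP (i : 'I_(1 + m)).
  rewrite [X in measurable_fun _ X](_ : _ = fst); first exact: measurable_fst.
  by apply/funext => x; exact: (etrans (row_mxEl _ _ _ _) (mxE _ _ _ _)).
rewrite [X in measurable_fun _ X](_ : _ = rV_coord j \o snd); last first.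
  by apply/funext => x; exact: row_mxEr.
exact: (measurableT_comp (measurable_rV_coord j) measurable_snd).
Qed.

Lemma measurable_rV_uncons m : measurable_fun setT (@rV_uncons m).
Proof.
apply: measurable_fun_pair; first exact: (measurable_rV_coord ord0).
apply/measurable_fun_rVP => i.
under eq_fun => x do rewrite mxE.
exact: (measurable_rV_coord (rshift 1 i)).
Qed.

Lemma rV_consK m : cancel (@rV_cons m) (@rV_uncons m).
Proof.
move=> [x v]; rewrite /rV_uncons /rV_cons row_mxKr; congr pair => /=.
have -> : ord0 = lshift m (ord0 : 'I_1) by exact/val_inj.
exact: (etrans (row_mxEl _ _ _ _) (mxE _ _ _ _)).
Qed.

Lemma rV_unconsK m : cancel (@rV_uncons m) (@rV_cons m).
Proof.
move=> x; rewrite /rV_uncons /rV_cons /=.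
have -> : const_mx (x ord0 ord0) = lsubmx (x : 'rV_(1 + m)).
  by apply/rowP => j; rewrite !mxE; congr (x _ _); apply/val_inj; rewrite ord1.
exact: (@hsubmxK _ 1 1 m x).
Qed.

Lemma lebesgue_rV_is_measure m :
  exists mu : {sigma_finite_measure set 'rV[R]_m -> \bar R},
    (mu : set _ -> \bar R) = @lebesgue_rV m.
Proof.
elim: m => [|m [mu muE]]; first by exists (dirac (0 : 'rV[R]_0)).
pose pm : {measure set (measurableTypeR R * 'rV[R]_m)%type -> \bar R} :=
  (lebesgue_measure \x mu)%E.
pose pf := pushforward pm (@rV_cons m).
have pf_sf : sigma_finite setT pf.
  have /sigma_finiteP[F [FT ndF Foo]] :=
    sigma_finiteT (@lebesgue_measure R : {sigma_finite_measure set _ -> \bar R}).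
  have /sigma_finiteP[G [GT ndG Goo]] := sigma_finiteT mu.
  have FG n : measurable (F n `*` G n) /\ (pm (F n `*` G n) < +oo)%E.
    have [mF Fn] := Foo n; have [mG Gn] := Goo n.
    split; first exact: measurableX.
    by rewrite /pm /= product_measure1E// lte_mul_pinfty// ge0_fin_numE.
  exists (fun n => @rV_uncons m @^-1` (F n `*` G n)).
    apply/esym/seteqP; split=> // x _.
    have : (\bigcup_i F i) (rV_uncons x).1 by rewrite -FT.
    have : (\bigcup_i G i) (rV_uncons x).2 by rewrite -GT.
    move=> [k _ Gk] [n _ Fn]; exists (maxn n k) => //; split.
    - by move: Fn; exact/subsetPset/ndF/leq_maxl.
    - by move: Gk; exact/subsetPset/ndG/leq_maxr.
  move=> n; have [mFn Fnoo] := FG n; split.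
    by rewrite -[X in measurable X]setTI; exact: measurable_rV_uncons.
  rewrite /pf /pushforward -comp_preimage.
  by rewrite (_ : _ \o _ = id)//; apply/funext => x /=; rewrite rV_consK.
pose M : {measure set 'rV[R]_m.+1 -> \bar R} :=
  measure_function_pushforward__canonical__measure_function_Measure pm
    (@measurable_rV_cons m).
pose sM := Measure_isSigmaFinite.Build _ _ _ (M : set _ -> \bar R) pf_sf.
pose S : {sigma_finite_measure set 'rV[R]_m.+1 -> \bar R} :=
  HB.pack (M : set _ -> \bar R) M sM.
by exists S; rewrite /= -muE.
Qed.

Let lebesgue_rV0 m : @lebesgue_rV m set0 = 0%E.
Proof. by have [mu <-] := lebesgue_rV_is_measure m; exact: measure0. Qed.

Let lebesgue_rV_ge0 m A : (0 <= @lebesgue_rV m A)%E.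
Proof. by have [mu <-] := lebesgue_rV_is_measure m; exact: measure_ge0. Qed.

Let lebesgue_rV_sigma_additive m : semi_sigma_additive (@lebesgue_rV m).
Proof.
have [mu <-] := lebesgue_rV_is_measure m.
exact: measure_semi_sigma_additive.
Qed.

HB.instance Definition _ m := isMeasure.Build _ _ _ (@lebesgue_rV m)
  (lebesgue_rV0 m) (@lebesgue_rV_ge0 m) (@lebesgue_rV_sigma_additive m).

Let lebesgue_rV_sigma_finite m : sigma_finite setT (@lebesgue_rV m).
Proof.
by have [mu <-] := lebesgue_rV_is_measure m; exact: sigma_finiteT.
Qed.

HB.instance Definition _ m := Measure_isSigmaFinite.Build _ _ _
  (@lebesgue_rV m) (@lebesgue_rV_sigma_finite m).

End lebesgue_rV.

Section independence.
Context {R : realType} {d} {Omega : measurableType d} (P : probability Omega R).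

Definition mutually_independent (I : eqType) d' (T : measurableType d')
    (X : I -> Omega -> T) :=
  forall (r : seq I) (A : I -> set T), uniq r -> (forall i, measurable (A i)) ->
    P (\bigcap_(i in [set` r]) X i @^-1` A i) =
    (\prod_(i <- r) P (X i @^-1` A i))%E.

Definition independent_systems (F G : set_system Omega) :=
  forall A B, F A -> G B -> P (A `&` B) = (P A * P B)%E.

End independence.

Definition sigma_of d (T : measurableType d) (Omega I : Type)
    (X : I -> Omega -> T) : set_system Omega :=
  <<s \bigcup_i preimage_set_system setT (X i) measurable >>.

Definition time_mesh {R : realType} (r : nat -> R) :=
  0 <= r 0%N /\ forall i, r i <= r i.+1.

(* Canonical space C_0([0,+oo[, R^k); a path is extended by 0 to negative
   times so that it is a continuous function on R. *)
Definition wiener_space (R : realType) (k : nat) :=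
  {w : R -> 'rV[R]_k | continuous w /\ forall v, v <= 0 -> w v = 0}.

Definition wiener_display : measure_display. Proof. exact. Qed.

Section wiener_space.
Context {R : realType} {k : nat}.
Local Notation W := (wiener_space R k).

Lemma wiener_path0 : continuous (fun _ : R => 0 : 'rV[R]_k) /\
  forall v : R, v <= 0 -> (0 : 'rV[R]_k) = 0.
Proof. by split=> // x; exact: cvg_cst. Qed.

HB.instance Definition _ := gen_eqMixin W.
HB.instance Definition _ := gen_choiceMixin W.
HB.instance Definition _ := isPointed.Build W (exist _ _ wiener_path0).

Definition path_at (v : R) (y : W) : 'rV[R]_k := sval y v.

Let wiener_set0 : sigma_of path_at set0.
Proof. exact: sigma_algebra0. Qed.

Let wiener_setC A : sigma_of path_at A -> sigma_of path_at (~` A).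
Proof. exact: sigma_algebraC. Qed.

Let wiener_bigcup (F : (set W)^nat) :
  (forall i, sigma_of path_at (F i)) -> sigma_of path_at (\bigcup_i F i).
Proof. exact: sigma_algebra_bigcup. Qed.

HB.instance Definition _ := @isMeasurable.Build wiener_display
  W (sigma_of path_at) wiener_set0 wiener_setC wiener_bigcup.

End wiener_space.

(* [normal_prob] takes the standard deviation as its second parameter. *)
Definition standard_brownian_motion {R : realType} d (Y : measurableType d)
    (mu : probability Y R) k (B : R -> Y -> 'rV[R]_k) :=
  [/\ forall v, 0 <= v -> measurable_fun setT (B v),
      forall y, B 0 y = 0,
      forall y, {within `[0, +oo[, continuous (B ^~ y)},
      forall r, time_mesh r -> mutually_independent mu
        (fun (p : nat * 'I_k) y =>
           B (r p.1.+1) y ord0 p.2 - B (r p.1) y ord0 p.2) &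
      forall u v (j : 'I_k) (E : set R), 0 <= u -> u < v -> measurable E ->
        mu [set y | E (B v y ord0 j - B u y ord0 j)] =
        normal_prob 0 (Num.sqrt (v - u)) E].

Definition wiener_measure {R : realType} k
    (mu : probability (wiener_space R k) R) :=
  standard_brownian_motion mu path_at.

Section levy.
Context {R : realType} {m : nat}.
Local Notation V := 'rV[R]_m.

(* [`|x|] is the max norm of the library; the integrability conditions do not
   depend on the choice of the norm on R^m. *)
Definition levy_measure (nu : {measure set V -> \bar R}) :=
  nu [set 0] = 0%E /\
  (\int[nu]_x (Num.min (`|x| ^+ 2) 1)%:E < +oo)%E.

Definition cadlag (z : R -> V) := forall u, 0 <= u ->
  z v @[v --> u^'+] --> z u /\ (0 < u -> cvg (z v @[v --> u^'-])).

Definition jump (z : R -> V) (u : R) : V := z u - lim (z v @[v --> u^'-]).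

Definition levy_process d (Omega : measurableType d) (P : probability Omega R)
    (Z : R -> Omega -> V) :=
  [/\ forall u, 0 <= u -> measurable_fun setT (Z u),
      {ae P, forall w, Z 0 w = 0},
      forall r, time_mesh r ->
        mutually_independent P (fun (i : nat) w => Z (r i.+1) w - Z (r i) w),
      forall u h (E : set V), 0 <= u -> 0 <= h -> measurable E ->
        P [set w | E (Z (u + h) w - Z u w)] = P [set w | E (Z h w)] &
      {ae P, forall w, cadlag (Z ^~ w)}].

Definition enumerates_jumps (z : R -> V) (sigma : nat -> R) (xi : nat -> V) :=
  [/\ injective sigma,
      forall n, [/\ 0 < sigma n, xi n = jump z (sigma n) & xi n != 0] &
      forall u, 0 < u -> jump z u != 0 -> exists n, sigma n = u].

Definition jump_partial_sum (sigma : nat -> R) (xi : nat -> V) (s : R)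
    (n : nat) : V :=
  \sum_(k < n | sigma k <= s) xi k.

Definition summable_jumps (z : R -> V) (sigma : nat -> R) (xi : nat -> V) :=
  forall s, 0 <= s ->
    (\sum_(0 <= k <oo | (sigma k <= s)%R) `|xi k|%:E < +oo)%E /\
    jump_partial_sum sigma xi s @ \oo --> z s.

Definition point_measure (sigma : nat -> R) (xi : nat -> V) :
    {measure set (measurableTypeR R * V)%type -> \bar R} :=
  mseries (fun n => dirac ((sigma n : measurableTypeR R), xi n)) 0.

(* du x nu on R_+ x R^m, as a measure on R x R^m carried by R_+ x R^m *)
Definition jump_intensity (nu : {measure set V -> \bar R}) :
    set (measurableTypeR R * V)%type -> \bar R :=
  (mrestr lebesgue_measure (measurable_itv `[0%R, +oo[) \x nu)%E.

End levy.

Definition poisson_random_measure {R : realType} d (Omega : measurableType d)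
    (P : probability Omega R) d' (T : measurableType d')
    (M : Omega -> {measure set T -> \bar R}) (Lambda : set T -> \bar R) :=
  [/\ forall E, measurable E -> measurable_fun setT (M ^~ E),
      forall E k, measurable E -> (Lambda E < +oo)%E ->
        P [set w | M w E = k%:R%:E] =
        (fine (Lambda E) ^+ k / k`!%:R * expR (- fine (Lambda E)))%:E,
      forall E, measurable E -> Lambda E = +oo%E ->
        P [set w | M w E = +oo%E] = 1%E &
      forall E : nat -> set T, (forall i, measurable (E i)) ->
        trivIset setT E -> mutually_independent P (fun i => M ^~ (E i))].

(* The points (sigma_n, xi_n) receive marks eta_n that are i.i.d. with law mu
   and jointly independent of all the points. *)
Definition iid_marks {R : realType} m d (Omega : measurableType d)
    (P : probability Omega R) d' (Y : measurableType d') (mu : probability Y R)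
    (sigma : nat -> Omega -> R) (xi : nat -> Omega -> 'rV[R]_m)
    (eta : nat -> Omega -> Y) :=
  [/\ forall n, measurable_fun setT (eta n),
      forall n E, measurable E -> P (eta n @^-1` E) = mu E,
      mutually_independent P eta &
      independent_systems P (sigma_of (fun n w => (sigma n w, xi n w)))
                            (sigma_of eta)].

Section transform.
Context {R : realType} {m k : nat}.
Local Notation V := 'rV[R]_m.
Local Notation W := (wiener_space R k).

(* In finite dimension, pointwise continuity of x |-> 'd f x is continuity in
   operator norm. *)
Definition C1 (f : V -> V) :=
  (forall x, differentiable f x) /\
  (forall h, continuous (fun x => 'd f x h)).

Definition solution (A : 'I_k -> V -> V) (B : V -> V -> V)
    (X : R -> V -> W -> V) :=
  forall x y, {within `[0, +oo[, continuous (fun v => X v x y)} /\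
    forall t, 0 <= t ->
      X t x y = x + \sum_j path_at t y ord0 j *: A j x
        + \row_i \int[lebesgue_measure]_(v in `[0, t]) B (X v x y) x ord0 i.

Definition transition_law (mu : probability W R) (X : R -> V -> W -> V)
    (t : R) (x : V) : set V -> \bar R := pushforward mu (X t x).

Definition transported_measure (nu : {measure set V -> \bar R})
    (mu : probability W R) (X : R -> V -> W -> V) (t : R) : set V -> \bar R :=
  fun E => (\int[nu]_x transition_law mu X t x E)%E.

(* (T_t(Z))_s when Z has jumps xi_n at times sigma_n, marked by eta_n; the
   value is arbitrary where the series diverges. *)
Definition jump_transform Omega (X : R -> V -> W -> V)
    (sigma : nat -> Omega -> R) (xi : nat -> Omega -> V)
    (eta : nat -> Omega -> W) (t s : R) (w : Omega) : V :=
  lim (jump_partial_sum (sigma ^~ w) (fun n => X t (xi n w) (eta n w)) s @ \oo).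

Definition lin_span (F : set V) : set V :=
  [set v | exists n (c : 'I_n -> R) (f : 'I_n -> V),
     (forall i, F (f i)) /\ v = \sum_i c i *: f i].

Definition span_has_dim (F : set V) (r : nat) :=
  exists U : {vspace V}, lin_span F = [set v | v \in U] /\ \dim U = r.

Definition has_density d (Omega : measurableType d) (P : probability Omega R)
    (T : Omega -> V) :=
  measurable_fun setT T /\
  exists f : V -> R, [/\ measurable_fun setT f, forall x, 0 <= f x &
    forall E, measurable E ->
      P (T @^-1` E) = (\int[@lebesgue_rV R m]_(x in E) (f x)%:E)%E].

End transform.

(* Main.v *)
Require Import Defs.
From HB Require Import structures.
From mathcomp Require Import all_boot all_order all_algebra.
From mathcomp Require Import all_classical all_reals all_analysis.
From mathcomp Require Import measurable_realfun ring lra zify.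
Import Order.TTheory GRing.Theory Num.Def Num.Theory.
Import numFieldNormedType.Exports.
Local Open Scope classical_set_scope.
Local Open Scope ring_scope.
Set Implicit Arguments.
Unset Strict Implicit.
Unset Printing Implicit Defensive.

(** Freeze the jumps [x_n] of [Z] before time [s] and keep only the marks
    random. There are infinitely many such jumps, they are nonzero and they tend
    to 0, so by hypothesis finitely many of the vectors [A_j x_n] span the space:
    there are matrices [w_n], all but finitely many zero, such that for every [h]
    the sum over [n] of the vectors [A_j x_n], with the coordinates of
    [h *m w_n] as coefficients, is [h] ([spanning_weights]).

    Shift the [n]-th Brownian mark by [h *m w_n], along a ramp that rises from 0
    to 1 on a final interval of length [eps] before [t]. The noise being
    additive, this moves the transform by [h] plus a correction due to the drift,
    and by Gronwall's inequality the correction is Lipschitz in [h] with a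
    constant of order [eps] ([solution_shift]). For small [eps] the transform is
    thus an expanding function of [h], and the set of the [h] for which it falls
    in a given Lebesgue-null set [E] is itself Lebesgue-null ([expanding_null],
    by comparing measures on dyadic cubes). By Fubini's theorem there is a
    deterministic [h] for which the transform with shifted marks avoids [E]
    almost surely. By the Cameron--Martin theorem ([wiener_shift_law]) and
    independence ([independent_change_of_law]), the shifted marks and the
    original ones have the same null events, so that the original transform
    avoids [E] almost surely as well ([fixed_points_null]).

    The marks being independent of the points, Fubini's theorem then lets the
    points vary ([jump_transform_null]). What is needed of almost every
    configuration of points comes from the Poisson random measure: there are
    infinitely many jumps because [nu] is infinite, and by Campbell's formula
    ([campbell_le]) the integrability of the transported measure makes the
    transformed jumps summable. The law of the transform is therefore absolutely
    continuous, and the Radon--Nikodym theorem gives the density. *)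

(** * Mixtures and weighted images of measures *)

Section mixture.
Context d d' (S : measurableType d) (T : measurableType d') (R : realType).
Variables (nu : {measure set S -> \bar R}) (kap : S -> {measure set T -> \bar R}).
Hypothesis mkap : forall E, measurable E -> measurable_fun setT (kap ^~ E).
Local Open Scope ereal_scope.

(** The measurability of the kernel is an argument, so that the measure
    structure of a mixture can be inferred from the term. *)
Definition mixture (_ : forall E, measurable E -> measurable_fun setT (kap ^~ E))
  : set T -> \bar R := fun E => \int[nu]_x kap x E.

Local Notation mix := (mixture mkap).

Let mixture0 : mix set0 = 0.
Proof. by rewrite /mixture integral0_eq// => x _; rewrite measure0. Qed.

Let mixture_ge0 E : 0 <= mix E.
Proof. exact: integral_ge0. Qed.

Let mixture_sigma_additive : semi_sigma_additive mix.
Proof.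
move=> F mF tF mUF; rewrite [X in _ --> X](_ : _ =
  \int[nu]_x (\sum_(n <oo) kap x (F n))); last first.
  apply: eq_integral => x _.
  by apply/esym/cvg_lim => //; exact/measure_semi_sigma_additive.
apply/cvg_closeP; split.
  by apply: is_cvg_nneseries => n _ _; exact: integral_ge0.
by rewrite closeE// integral_nneseries// => n; exact: mkap.
Qed.

HB.instance Definition _ := isMeasure.Build _ _ _ mix
  mixture0 mixture_ge0 mixture_sigma_additive.

Import HBNNSimple.

(** Both sides commute with increasing limits of simple functions, and agree on
    simple functions by the definition of the mixture. *)
Lemma integral_mixture (f : T -> \bar R) : measurable_fun setT f ->
  (forall y, 0 <= f y) ->
  \int[mix]_y f y = \int[nu]_x (\int[kap x]_y f y).
Proof.
move=> mf f0; pose f_ := nnsfun_approx measurableT mf.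
have f_cvg (m : {measure set T -> \bar R}) :
    \int[m]_y f y = limn (fun n => \int[m]_y (f_ n y)%:E).
  rewrite -monotone_convergence//.
  - apply: eq_integral => y _; apply/esym/cvg_lim => //.
    exact: cvg_nnsfun_approx.
  - by move=> n; exact/measurable_EFinP.
  - by move=> n y _; rewrite lee_fin.
  - by move=> y _ a b ab; rewrite lee_fin; exact/lefP/nd_nnsfun_approx.
have mint n : measurable_fun setT (fun x => \int[kap x]_y (f_ n y)%:E).
  apply: measurable_fun_integral_kernel => //.
  - by move=> z; rewrite lee_fin.
  - exact/measurable_EFinP.
rewrite f_cvg; under [RHS]eq_integral do rewrite f_cvg.
rewrite monotone_convergence//; last 2 first.
- by move=> n x _; apply: integral_ge0 => z _; rewrite lee_fin.
- move=> x _ a b ab; apply: ge0_le_integral => //.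
  + by move=> z _; rewrite lee_fin.
  + exact/measurable_EFinP.
  + exact/measurable_EFinP.
  + by move=> z _; rewrite lee_fin; exact/lefP/nd_nnsfun_approx.
apply/congr_lim/funext => n.
rewrite integralT_nnsfun sintegralE.
under [RHS]eq_integral do rewrite integralT_nnsfun sintegralE.
rewrite ge0_integral_fsum//=; last 2 first.
- by move=> r; apply: measurable_funeM; exact: mkap.
- move=> r x _; have [r0|r0] := leP 0%R r; first by rewrite mule_ge0.
  by rewrite preimage_nnfun0// measure0 mule0.
apply: eq_fsbigr => r _; have [r0|r0] := leP 0%R r.
  by rewrite ge0_integralZl//; exact: mkap.
have e : f_ n @^-1` [set r] = set0 by exact: preimage_nnfun0.
by rewrite e measure0 mule0 integral0_eq// => x _; rewrite measure0 mule0.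
Qed.

End mixture.

Section weighting.
Context d d' (S : measurableType d) (T : measurableType d') (R : realType).
Variables (P : {measure set S -> \bar R}) (X : S -> T) (g : S -> R).
Hypothesis mX : measurable_fun setT X.
Hypothesis mg : measurable_fun setT g.
Hypothesis g0 : forall x, 0 <= g x.
Local Open Scope ereal_scope.

Let kap x : {measure set T -> \bar R} := mscale (NngNum (g0 x)) \d_(X x).

Let kapE x E : kap x E = (g x * \1_E (X x))%:E.
Proof. by rewrite /kap /= /mscale/= diracE EFinM indicE. Qed.

Let mkap E : measurable E -> measurable_fun setT (kap ^~ E).
Proof.
move=> mE; under eq_fun do rewrite kapE.
apply/measurable_EFinP; apply: measurable_funM => //.
exact: (measurableT_comp (measurable_indic mE) mX).
Qed.

(** The mixture of the point masses at [X x], weighted by [g x], is the image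
    under [X] of the measure of density [g]. Every change of law below, and the
    intensity of the jumps, is compared with such a measure. *)
Lemma weighting_measure : exists m : {measure set T -> \bar R},
  (forall E, measurable E -> m E = \int[P]_x (g x * \1_E (X x))%:E) /\
  forall f, measurable_fun setT f -> (forall y, 0 <= f y) ->
    \int[m]_y f y = \int[P]_x ((g x)%:E * f (X x)).
Proof.
exists (mixture P mkap); split=> [E mE|f mf f0].
  by rewrite /= /mixture; apply: eq_integral => x _; rewrite kapE.
rewrite integral_mixture//; apply: eq_integral => x _.
by rewrite ge0_integral_mscale// integral_dirac// diracT mul1e.
Qed.

End weighting.

(** * Independence and change of law *)

Section product_expectation.
Context d (Omega : measurableType d) d' (T : measurableType d') (R : realType).
Variables (P : probability Omega R) (I : eqType) (zeta : I -> Omega -> T).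
Hypothesis mzeta : forall i, measurable_fun setT (zeta i).
Hypothesis indep : mutually_independent P zeta.
Local Open Scope ereal_scope.

(* Functions are exchanged for indicators one factor at a time: for fixed
   remaining factors, the expectation is a measure in the last indicator, and
   is proportional to the law of [zeta i]; integrate [f i] against both. *)
Let expectation_prod_aux (f : I -> T -> R) (A : I -> set T) (l1 l2 : seq I) :
  (forall i, measurable_fun setT (f i)) -> (forall i x, (0 <= f i x)%R) ->
  (forall i, \int[P]_w (f i (zeta i w))%:E < +oo) ->
  (forall i, measurable (A i)) -> uniq (l1 ++ l2) ->
  \int[P]_w (\prod_(i <- l1) f i (zeta i w) *
             \prod_(i <- l2) \1_(A i) (zeta i w))%:E =
  \prod_(i <- l1) \int[P]_w (f i (zeta i w))%:E *
  \prod_(i <- l2) P (zeta i @^-1` A i).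
Proof.
move=> mf f0 foo; elim: l1 l2 A => [|i l1 IH] l2 A mA ul.
  under eq_integral do rewrite big_nil mul1r.
  rewrite big_nil mul1e -(indep ul mA).
  have mB : measurable (\bigcap_(i in [set` l2]) zeta i @^-1` A i).
    apply: fin_bigcap_measurable => // i _.
    by rewrite -[X in measurable X]setTI; exact: mzeta.
  rewrite -[in RHS](setIT (\bigcap_(i in _) _)) -integral_indic//.
  apply: eq_integral => w _; congr EFin.
  rewrite [in RHS]indicE; have [/set_mem h|h] := boolP (w \in _).
    rewrite big_seq big1// => i il; rewrite indicE mem_set//.
    exact: h.
  have [i il nA] : exists2 i, i \in l2 & ~ A i (zeta i w).
    apply: contrapT => nex; move/negP: h; apply; apply/mem_set => i /= il.
    by apply: contrapT => nA; apply: nex; exists i.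
  by rewrite (big_rem i)//= indicE memNset// mul0r.
pose G w := (\prod_(j <- l1) f j (zeta j w) *
             \prod_(j <- l2) \1_(A j) (zeta j w))%R.
have mG : measurable_fun setT G.
  apply: measurable_funM; apply: measurable_prod => j _.
    exact: measurableT_comp.
  exact: (measurableT_comp (measurable_indic (mA j)) (mzeta j)).
have G0 w : (0 <= G w)%R by rewrite mulr_ge0// prodr_ge0.
have [m [mE mint]] := weighting_measure P (mzeta i) mG G0.
move: (ul); rewrite cat_cons cons_uniq => /andP[il ul'].
have il2 : i \notin l2 by move: il; rewrite mem_cat negb_or => /andP[].
pose c := \prod_(j <- l1) \int[P]_w (f j (zeta j w))%:E *
          \prod_(j <- l2) P (zeta j @^-1` A j).
have c0 : 0 <= c.
  apply: mule_ge0; apply: prode_ge0 => j _ //.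
  by apply: integral_ge0 => w _; rewrite lee_fin.
have cfin : c \is a fin_num.
  apply: fin_numM; apply: prode_fin_num => j _; last first.
    by apply: fin_num_measure; rewrite -[X in measurable X]setTI; exact: mzeta.
  by rewrite ge0_fin_numE//; apply: integral_ge0 => w _; rewrite lee_fin.
have mP E : measurable E -> m E = c * P (zeta i @^-1` E).
  move=> mE'; rewrite mE//.
  pose A' j := if j == i then E else A j.
  have mA' j : measurable (A' j) by rewrite /A'; case: ifP.
  have A'E j : j \in l2 -> A' j = A j.
    by move=> jl2; rewrite /A' ifF//; apply: contraNF il2 => /eqP <-.
  have ul2 : uniq (l1 ++ i :: l2) by rewrite uniq_catC cat_cons/= mem_cat
      orbC -mem_cat uniq_catC il.
  have := IH (i :: l2) A' mA' ul2.
  rewrite !big_cons {2}/A' eqxx [X in _ = _ * (_ * X)](@eq_big_seq _ _ _ _ _ _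
    (fun j => P (zeta j @^-1` A j))) => [|j jl2]; last by rewrite A'E.
  rewrite muleCA muleC -/c => <-.
  apply: eq_integral => w _; congr EFin.
  rewrite big_cons /A' eqxx /G -mulrA; congr *%R; rewrite mulrC; congr *%R.
  by apply: eq_big_seq => j jl2; rewrite -/(A' j) A'E.
have -> : (fun w => (\prod_(j <- (i :: l1)) f j (zeta j w) *
             \prod_(j <- l2) \1_(A j) (zeta j w))%:E) =
          (fun w => (G w)%:E * (f i (zeta i w))%:E).
  by apply/funext => w; rewrite big_cons -mulrA mulrC EFinM.
rewrite -(mint (EFin \o f i)); last 2 first.
- exact/measurable_EFinP.
- by move=> y; rewrite lee_fin.
have cE : c = (NngNum (fine_ge0 c0))%:num%:E by rewrite /= fineK.
rewrite (eq_measure_integral (mscale (NngNum (fine_ge0 c0))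
  (pushforward P (zeta i)))); last first.
  by move=> E mE' _; rewrite mP// /= /mscale/= fineK.
rewrite ge0_integral_mscale//; last 2 first.
- exact/measurable_EFinP.
- by move=> y _; rewrite lee_fin.
rewrite -cE ge0_integral_pushforward//=; last 2 first.
- exact/measurable_EFinP.
- by move=> y _; rewrite lee_fin.
by rewrite preimage_setT [in RHS]big_cons -[in RHS]muleA -/c muleC.
Qed.

Lemma expectation_prod_indep (f : I -> T -> R) (l : seq I) :
  (forall i, measurable_fun setT (f i)) -> (forall i x, (0 <= f i x)%R) ->
  (forall i, \int[P]_w (f i (zeta i w))%:E < +oo) -> uniq l ->
  \int[P]_w (\prod_(i <- l) f i (zeta i w))%:E =
  \prod_(i <- l) \int[P]_w (f i (zeta i w))%:E.
Proof.
move=> mf f0 foo ul.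
have := @expectation_prod_aux f (fun=> setT) l [::] mf f0 foo (fun=> measurableT).
rewrite cats0 big_nil mule1 => <-//.
by apply: eq_integral => w _; rewrite big_nil mulr1.
Qed.

End product_expectation.

(** Only finitely many coordinates are constrained, but the values of [A] off
    the list [l] are recorded, which keeps intersections simple. *)
Definition cylinder (I : eqType) d (T : measurableType d) : set_system (I -> T) :=
  [set E | exists (l : seq I) (A : I -> set T),
     [/\ forall i, measurable (A i), forall i, i \notin l -> A i = setT &
         E = [set h | forall i, A i (h i)]]].

Notation family_space I T := (g_sigma_algebraType (@cylinder I _ T)).

Section family_space.
Context (I : eqType) d (T : measurableType d).

Lemma setI_closed_cylinder : setI_closed (@cylinder I d T).
Proof.
move=> _ _ [l [A [mA lA ->]]] [l' [A' [mA' lA' ->]]].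
exists (l ++ l'), (fun i => A i `&` A' i); split.
- by move=> i; exact: measurableI.
- by move=> i; rewrite mem_cat negb_or => /andP[il il']; rewrite lA// lA'// setIT.
- apply/seteqP; split=> [h [hA hA'] i|h hh]; first by split; [exact: hA|exact: hA'].
  by split=> i; have [] := hh i.
Qed.

Lemma measurable_eval (i : I) :
  measurable_fun setT (fun h : family_space I T => h i).
Proof.
move=> _ A mA; rewrite setTI; apply: sub_sigma_algebra.
exists [:: i], (fun j => if j == i then A else setT); split=> [j|j|].
- by case: ifP.
- by rewrite inE => /negbTE ->.
- apply/seteqP; split=> [h hA j|h /(_ i)]; last by rewrite eqxx.
  by case: eqP => [->|].
Qed.

Lemma measurable_family d' (Omega : measurableType d') (zeta : I -> Omega -> T) :
  (forall i, measurable_fun setT (zeta i)) ->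
  measurable_fun setT ((fun w i => zeta i w) : Omega -> family_space I T).
Proof.
move=> mzeta; apply: (@measurability _ _ _ (family_space I T) _ _ (@cylinder I d T)) => //.
move=> _ [_ [l [A [mA lA ->]]] <-]; rewrite setTI.
rewrite (_ : _ @^-1` _ = \bigcap_(i in [set` l]) (zeta i @^-1` A i)).
  apply: fin_bigcap_measurable => // i _.
  by rewrite -[X in measurable X]setTI; exact: mzeta.
apply/seteqP; split=> [w h i _|w h i]; first exact: h.
by have [il|il] := boolP (i \in l); [exact: h|rewrite lA].
Qed.

End family_space.

Section independent_change_of_law.
Context d (Omega : measurableType d) d' (T : measurableType d') (R : realType).
Variables (P : probability Omega R) (I : eqType) (zeta : I -> Omega -> T).
Variables (tau : I -> T -> T) (z : I -> T -> R) (r : seq I).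
Hypothesis mzeta : forall i, measurable_fun setT (zeta i).
Hypothesis indep : mutually_independent P zeta.
Hypothesis mtau : forall i, measurable_fun setT (tau i).
Hypothesis mz : forall i, measurable_fun setT (z i).
Hypothesis z0 : forall i x, 0 <= z i x.
Hypothesis ur : uniq r.
Hypothesis zr : forall i x, i \notin r -> z i x = 1.
Hypothesis law : forall i A, measurable A ->
  P (zeta i @^-1` (tau i @^-1` A)) =
  (\int[P]_w (z i (zeta i w) * \1_A (zeta i w))%:E)%E.
Local Open Scope ereal_scope.

(** The densities multiply, because expectations of products do: this identifies
    the two laws on cylinders, which form a pi-system. Only finitely many
    coordinates are moved, so that the product of densities is finite. *)
Lemma independent_change_of_law (E : set (family_space I T)) : measurable E ->
  P [set w | E (fun i => tau i (zeta i w))] =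
  \int[P]_w ((\prod_(i <- r) z i (zeta i w)) * \1_E (fun i => zeta i w))%:E.
Proof.
move=> mE.
pose G w := (\prod_(i <- r) z i (zeta i w))%R.
have mG : measurable_fun setT G.
  by apply: measurable_prod => i _; exact: measurableT_comp.
have G0 w : (0 <= G w)%R by rewrite prodr_ge0.
have mtz i : measurable_fun setT (tau i \o zeta i) by exact: measurableT_comp.
have [m [mE' _]] := weighting_measure P (measurable_family mzeta) mG G0.
rewrite -(mE' _ mE).
have mfam := measurable_family mtz.
pose m1' : {measure set (family_space I T) -> \bar R} :=
  measure_function_pushforward__canonical__measure_function_Measure P mfam.
rewrite [LHS](_ : _ = m1' E)//.
apply: (@measure_unique _ _ (family_space I T) (@cylinder I d' T) (fun=> setT) _ _ _ _ m1' m) => //.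
- exact: setI_closed_cylinder.
- by move=> _; exists [::], (fun=> setT); split=> //; apply/seteqP; split.
- by rewrite bigcup_const//; exists 0%N.
- move=> C [l [A [mA lA CE]]]; have mC : measurable C.
    by apply: sub_sigma_algebra; exists l, A.
  rewrite mE'//.
  pose L := undup (l ++ r).
  have uL : uniq L by exact: undup_uniq.
  have notL i : i \notin L -> i \notin l /\ i \notin r.
    by rewrite mem_undup mem_cat negb_or => /andP.
  have ctau i : measurable (tau i @^-1` A i).
    by rewrite -[X in measurable X]setTI; exact: mtau.
  transitivity (P (\bigcap_(i in [set` L]) zeta i @^-1` (tau i @^-1` A i))).
    rewrite /m1' /= /pushforward/= CE; congr (P _).
    apply/seteqP; split=> [w h i _|w h i]; first exact: h.
    have [iL|/notL[il _]] := boolP (i \in L); first exact: h.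
    by rewrite lA.
  rewrite indep//; under eq_bigr do rewrite law//.
  pose f i x := (z i x * \1_(A i) x)%R.
  have mf i : measurable_fun setT (f i) by apply: measurable_funM.
  have f0 i x : (0 <= f i x)%R by rewrite mulr_ge0.
  rewrite -(@expectation_prod_indep _ _ _ _ _ _ _ _ mzeta indep f)//; last first.
    by move=> i; rewrite -law// ltey_eq fin_num_measure// -[X in measurable X]setTI; exact: mzeta.
  apply: eq_integral => w _; congr EFin.
  rewrite big_split/=; congr *%R.
    rewrite /L (perm_big (r ++ [seq i <- undup l | i \notin r]))/=; last first.
      apply: uniq_perm => //.
        rewrite cat_uniq ur filter_uniq ?undup_uniq// andbT/=.
        by apply/hasPn => i; rewrite mem_filter => /andP[].
      move=> i; rewrite mem_undup !mem_cat mem_filter mem_undup.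
      by case: (i \in r); rewrite ?orbT ?orbF.
    rewrite big_cat/= [X in (_ * X)%R]big1_seq ?mulr1// => i.
    by rewrite mem_filter => /andP[_ /andP[ir _]]; exact: zr.
  rewrite [in RHS]indicE; have [/set_mem h|h] := boolP (_ \in C).
    rewrite big_seq big1// => i il; rewrite indicE mem_set//.
    by move: h; rewrite CE; exact.
  have [i nA] : exists i, ~ A i (zeta i w).
    apply: contrapT => nex; move/negP: h; apply; apply/mem_set; rewrite CE => i.
    by apply: contrapT => nA; apply: nex; exists i.
  have iL : i \in L.
    by apply/negPn/negP => /notL[il _]; apply: nA; rewrite lA.
  by rewrite (big_rem i)//= indicE memNset// mul0r.
- by move=> _; rewrite /m1' /= /pushforward preimage_setT probability_setT ltry.
Qed.

End independent_change_of_law.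

(** * Translations of normal laws *)

Section gaussian_shift.
Context {R : realType}.
Implicit Types a c s v x : R.

Lemma lebesgue_measure_shift c (A : set R) : measurable A ->
  lebesgue_measure ((fun x => x + c) @^-1` A) = lebesgue_measure A.
Proof.
move=> mA; have mshift : measurable_fun setT
    ((fun x => x + c) : measurableTypeR R -> measurableTypeR R).
  exact: measurable_funD.
pose m : {measure set (measurableTypeR R) -> \bar R} :=
  measure_function_pushforward__canonical__measure_function_Measure
    lebesgue_measure mshift.
rewrite [RHS](@lebesgue_measure_unique R m)// => _ [[a b]] _ <-.
rewrite /m /= /pushforward/= (_ : _ @^-1` _ = `]a - c, b - c]%classic).
  rewrite !lebesgue_measure_itv/= !lte_fin ltrD2r.
  by case: ifPn => // _; rewrite -!EFinD; congr EFin; rewrite opprB addrA subrK.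
by apply/seteqP; split=> x /=; rewrite !in_itv/= ltrBlDr lerBrDr.
Qed.

Lemma ge0_integral_lebesgue_shift c (f : R -> \bar R) : measurable_fun setT f ->
  (forall x, (0 <= f x)%E) ->
  (\int[lebesgue_measure]_x f (x + c)%R = \int[lebesgue_measure]_x f x)%E.
Proof.
move=> mf f0; have mshift : measurable_fun setT
    ((fun x => x + c) : measurableTypeR R -> measurableTypeR R).
  exact: measurable_funD.
rewrite [RHS](eq_measure_integral
  (measure_function_pushforward__canonical__measure_function_Measure
    (@lebesgue_measure R) mshift)).
  by rewrite ge0_integral_pushforward.
by move=> A mA _; rewrite /= /pushforward lebesgue_measure_shift.
Qed.

(** The density of the normal law of mean [a] and variance [v] with respect to
    the centered one. *)
Definition gaussian_tilt v a x := expR (a * x / v - a ^+ 2 / (v *+ 2)).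

Lemma gaussian_tilt_ge0 v a x : 0 <= gaussian_tilt v a x.
Proof. exact: expR_ge0. Qed.

Lemma measurable_gaussian_tilt v a : measurable_fun setT (gaussian_tilt v a).
Proof.
apply: measurableT_comp => //; apply: measurable_funB => //.
by apply: measurable_funM => //; exact: measurable_funM.
Qed.

Lemma normal_pdf_shift s a x : s != 0 ->
  normal_pdf 0 s (x - a) = gaussian_tilt (s ^+ 2) a x * normal_pdf 0 s x.
Proof.
move=> s0; rewrite !normal_pdfE// [RHS]mulrCA; congr *%R.
rewrite /gaussian_tilt /normal_fun -expRD; congr expR.
by rewrite -mulr_natr; field; rewrite s0.
Qed.

(** The normal law is defined set by set; its integral is identified through the
    weighted measure of density [normal_pdf]. *)
Lemma ge0_integral_normal_prob s (f : R -> \bar R) : measurable_fun setT f ->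
  (forall x, (0 <= f x)%E) ->
  (\int[normal_prob 0 s]_x f x =
   \int[lebesgue_measure]_x ((normal_pdf 0 s x)%:E * f x))%E.
Proof.
move=> mf f0.
have mid : measurable_fun setT (id : measurableTypeR R -> measurableTypeR R) by [].
have [m [mE mint]] := weighting_measure lebesgue_measure mid
  (measurable_normal_pdf 0 s) (normal_pdf_ge0 0 s).
rewrite -mint//; apply: (@eq_measure_integral _ _ _ setT m) => A mA _.
rewrite [RHS]mE//.
rewrite /= /normal_prob [LHS]integral_mkcond; apply: eq_integral => x _.
by rewrite patchE indicE; case: ifPn => _; rewrite ?mulr1 ?mulr0.
Qed.

(** Completing the square: translating the Gaussian density multiplies it by
    [gaussian_tilt]. *)
Lemma normal_prob_shift s a (A : set R) : s != 0 -> measurable A ->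
  normal_prob 0 s ((fun x => x + a) @^-1` A) =
  (\int[normal_prob 0 s]_x (gaussian_tilt (s ^+ 2) a x * \1_A x)%:E)%E.
Proof.
move=> s0 mA; rewrite ge0_integral_normal_prob; last 2 first.
- apply/measurable_EFinP; apply: measurable_funM => //.
  exact: measurable_gaussian_tilt.
- by move=> x; rewrite lee_fin mulr_ge0// gaussian_tilt_ge0.
rewrite /normal_prob [LHS]integral_mkcond.
transitivity (\int[lebesgue_measure]_x
    (normal_pdf 0 s ((x + a) - a) * \1_A (x + a))%:E)%E.
  apply: eq_integral => x _; rewrite patchE addrK indicE.
  have [/set_mem/= h|h] := boolP (x \in _); first by rewrite mem_set// mulr1.
  by rewrite memNset ?mulr0// => h'; move/negP: h; apply; exact/mem_set.
rewrite (@ge0_integral_lebesgue_shift a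
  (fun x => (normal_pdf 0 s (x - a) * \1_A x)%:E)); last 2 first.
- apply/measurable_EFinP; apply: measurable_funM => //.
  apply: (measurableT_comp (measurable_normal_pdf 0 s)).
  exact: measurable_funB.
- by move=> x; rewrite lee_fin mulr_ge0// normal_pdf_ge0.
apply: eq_integral => x _; rewrite normal_pdf_shift// -EFinM; congr EFin.
by ring.
Qed.

End gaussian_shift.

(** * Shifts of Wiener paths on a final interval *)

Section wiener_shift.
Context {R : realType} {k : nat}.
Variables (t : R) (Q : nat).
Hypotheses (t_gt0 : 0 < t) (Q_gt0 : (0 < Q)%N).
Local Notation W := (wiener_space R k).
Implicit Types (y : W) (v : 'rV[R]_k).

Definition ramp_len : R := t / Q%:R.
Local Notation eps := ramp_len.

Lemma ramp_len_gt0 : 0 < eps.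
Proof. by rewrite divr_gt0// ltr0n. Qed.

Lemma ramp_len_le : eps <= t.
Proof. by rewrite ler_pdivrMr ?ltr0n// ler_peMr ?ler1n// ltW. Qed.

(** Rises linearly from 0 to 1 on the interval from [t - eps] to [t]. Adding it
    to a path changes the path at time [t] by a full unit, but leaves it alone
    except during the last [eps] units of time. *)
Definition ramp (u : R) : R := maxr 0 (minr u t - (t - eps)) / eps.

Lemma ramp_le u : u <= t - eps -> ramp u = 0.
Proof.
move=> ut; rewrite /ramp max_l ?mul0r// subr_le0.
by rewrite ge_min ut.
Qed.

Lemma ramp_ge u : t <= u -> ramp u = 1.
Proof.
move=> tu; rewrite /ramp min_r// opprB addrC subrK max_r ?divff ?gt_eqF//.
- exact: ramp_len_gt0.
- by rewrite ltW// ramp_len_gt0.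
Qed.

Lemma ramp_itv u : t - eps <= u <= t -> ramp u = (u - (t - eps)) / eps.
Proof. by move=> /andP[h1 h2]; rewrite /ramp min_l// max_r// subr_ge0. Qed.

Lemma ramp_ge0 u : 0 <= ramp u.
Proof.
by apply: divr_ge0; [rewrite le_max lexx|exact/ltW/ramp_len_gt0].
Qed.

Lemma ramp_le1 u : ramp u <= 1.
Proof.
rewrite ler_pdivrMr ?ramp_len_gt0// mul1r ge_max ltW ?ramp_len_gt0//=.
by rewrite lerBlDr addrC subrK ge_min lexx orbT.
Qed.

Lemma continuous_ramp : continuous ramp.
Proof.
move=> u; apply: cvgM; last exact: cvg_cst.
have h : {for u, continuous ((fun=> 0) \max ((id \min cst t) \- cst (t - eps)))}.
  apply: continuous_max; first exact: cvg_cst.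
  apply: cvgB; last exact: cvg_cst.
  by apply: continuous_min; [exact: cvg_id|exact: cvg_cst].
exact: h.
Qed.

Lemma wiener_shift_subproof y v :
  continuous (fun u => sval y u + ramp u *: v) /\
  forall u, u <= 0 -> sval y u + ramp u *: v = 0.
Proof.
split=> [u|u u0].
  apply: cvgD; first exact: (proj1 (svalP y)).
  by apply: cvgZ; [exact: continuous_ramp|exact: cvg_cst].
rewrite (proj2 (svalP y))// ramp_le ?scale0r ?addr0//.
by rewrite (le_trans u0)// subr_ge0 ramp_len_le.
Qed.

Definition wiener_shift y v : W :=
  exist _ (fun u => sval y u + ramp u *: v) (wiener_shift_subproof y v).

Lemma path_at_shift u y v :
  path_at u (wiener_shift y v) = path_at u y + ramp u *: v.
Proof. by []. Qed.

Lemma measurable_path_at u : measurable_fun setT (@path_at R k u).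
Proof.
move=> _ A mA; apply: sub_sigma_algebra; exists u => //.
by exists A.
Qed.

Lemma measurable_path_coord u j :
  measurable_fun setT (fun y : W => path_at u y ord0 j).
Proof. exact: (measurableT_comp (measurable_rV_coord j) (measurable_path_at u)). Qed.

Lemma measurable_to_wiener d (T : measurableType d) (f : T -> W) :
  (forall u, measurable_fun setT (path_at u \o f)) -> measurable_fun setT f.
Proof.
move=> mf; apply: (@measurability _ _ _ W _ _
  (\bigcup_i preimage_set_system setT (@path_at R k i) measurable)) => //.
move=> _ [_ [u _ [A mA <-]] <-]; rewrite !setTI -comp_preimage.
by rewrite -[X in measurable X]setTI; exact: mf.
Qed.

(** Since [eps] is [t / Q], both ends [t - eps] and [t] of the ramp are points
    of every mesh, and the ramp is linear between consecutive mesh points. *)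
Definition mesh_step n : R := eps / (2 ^ n)%:R.
Definition mesh n i : R := i%:R * mesh_step n.

Lemma mesh_step_gt0 n : 0 < mesh_step n.
Proof. by rewrite divr_gt0 ?ramp_len_gt0// ltr0n expn_gt0. Qed.

Lemma meshS n i : mesh n i.+1 = mesh n i + mesh_step n.
Proof. by rewrite /mesh -natr1 mulrDl mul1r. Qed.

Lemma mesh_double n i : mesh n.+1 i.*2 = mesh n i.
Proof.
rewrite /mesh /mesh_step expnS natrM -muln2 natrM.
by field; rewrite !pnatr_eq0 -lt0n expn_gt0.
Qed.

Lemma mesh_time n : time_mesh (mesh n).
Proof.
split; first by rewrite /mesh mul0r.
by move=> i; rewrite meshS lerDl ltW// mesh_step_gt0.
Qed.

Lemma mesh_end n : mesh n (Q * 2 ^ n) = t.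
Proof.
rewrite /mesh /mesh_step natrM /ramp_len.
by field; rewrite !pnatr_eq0 -!lt0n Q_gt0 expn_gt0.
Qed.

Lemma mesh_start n : mesh n (Q.-1 * 2 ^ n) = t - eps.
Proof.
have stepE : (2 ^ n)%:R * mesh_step n = eps.
  by rewrite /mesh_step mulrC divfK// pnatr_eq0 -lt0n expn_gt0.
rewrite -[X in X - _](mesh_end n) -[in RHS](prednK Q_gt0) /mesh mulSn natrD.
by rewrite mulrDl stepE addrAC subrr add0r.
Qed.

Definition increment n (p : nat * 'I_k) (y : W) : R :=
  path_at (mesh n p.1.+1) y ord0 p.2 - path_at (mesh n p.1) y ord0 p.2.

Definition ramp_increment n i : R := ramp (mesh n i.+1) - ramp (mesh n i).

Lemma measurable_increment n p : measurable_fun setT (increment n p).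
Proof. by apply: measurable_funB; exact: measurable_path_coord. Qed.

Lemma increment_shift n p y v : increment n p (wiener_shift y v) =
  increment n p y + ramp_increment n p.1 * v ord0 p.2.
Proof. by rewrite /increment !path_at_shift !mxE /ramp_increment; ring. Qed.

Lemma mesh_le n i j : (i <= j)%N -> mesh n i <= mesh n j.
Proof. by move=> ij; rewrite ler_wpM2r ?ler_nat// ltW// mesh_step_gt0. Qed.

Lemma ramp_incrementE n i : ramp_increment n i =
  if (Q.-1 * 2 ^ n <= i < Q * 2 ^ n)%N then mesh_step n / eps else 0.
Proof.
rewrite /ramp_increment; have [bi|ib] /= := leqP (Q.-1 * 2 ^ n) i; last first.
  by rewrite !ramp_le ?subrr// -(mesh_start n) mesh_le// ltnW.
have [ie|ei] := ltnP i (Q * 2 ^ n); last first.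
  by rewrite !ramp_ge ?subrr// -(mesh_end n) mesh_le// leqW.
rewrite !ramp_itv -?(mesh_start n) -?[X in _ <= X <= t]/(mesh n _).
- by rewrite -mulrBl meshS; congr (_ / _); ring.
- by rewrite mesh_le// -[leRHS](mesh_end n) mesh_le// ltnW.
- by rewrite mesh_le ?leqW// -[leRHS](mesh_end n) mesh_le.
Qed.

Lemma measurable_wiener_shift v : measurable_fun setT (wiener_shift ^~ v).
Proof.
apply: measurable_to_wiener => u; apply/measurable_fun_rVP => j.
rewrite [X in measurable_fun _ X](_ : _ =
    (fun y => path_at u y ord0 j + ramp u * v ord0 j)).
  by apply: measurable_funD => //; exact: measurable_path_coord.
by apply/funext => y; rewrite /= mxE [X in _ + X]mxE.
Qed.

End wiener_shift.

Section cameron_martin.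
Context {R : realType} {k : nat}.
Variables (t : R) (Q : nat).
Hypotheses (t_gt0 : 0 < t) (Q_gt0 : (0 < Q)%N).
Local Notation W := (wiener_space R k).
Local Notation eps := (ramp_len t Q).
Local Notation msh := (mesh t Q).
Local Notation step := (mesh_step t Q).
Local Notation increment := (@increment R k t Q).
Local Notation IK := (nat * 'I_k)%type.

(** Events that only depend on the increments along the mesh of order [n]. These
    systems grow with [n], so that their union is a pi-system; it generates the
    sigma-algebra of Wiener space by continuity of the paths. *)
Definition increment_system n : set_system W :=
  [set E | exists F : set (family_space IK R), measurable F /\
    E = [set y | F (fun p => increment n p y)]].

Lemma increment_split n (p : IK) y : increment n p y =
  increment n.+1 (p.1.*2, p.2) y + increment n.+1 (p.1.*2.+1, p.2) y.
Proof.
rewrite /increment/= -doubleS !mesh_double//; ring.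
Qed.

Lemma increment_system_nondecreasing n m : (n <= m)%N ->
  increment_system n `<=` increment_system m.
Proof.
elim: m => [|m IH]; first by rewrite leqn0 => /eqP ->.
rewrite leq_eqVlt => /predU1P[->//|]; rewrite ltnS => /IH /subset_trans; apply.
move=> _ [F [mF ->]].
pose psi (h : family_space IK R) : family_space IK R :=
  fun p => h (p.1.*2, p.2) + h (p.1.*2.+1, p.2).
have mpsi : measurable_fun setT psi.
  apply: measurable_family => p.
  by apply: measurable_funD; exact: measurable_eval.
exists (psi @^-1` F); split.
  by rewrite -[X in measurable X]setTI; exact: mpsi.
have e y : psi (fun p => increment m.+1 p y) = (fun p => increment m p y).
  by apply/funext => p; rewrite /psi [RHS]increment_split.
by apply/seteqP; split=> y /=; rewrite e.
Qed.

Definition increment_systems : set_system W := \bigcup_n increment_system n.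

Lemma setI_closed_increment_systems : setI_closed increment_systems.
Proof.
move=> E E' [n _ En] [n' _ En'].
have [F [mF ->]] := increment_system_nondecreasing (leq_maxl n n') En.
have [F' [mF' ->]] := increment_system_nondecreasing (leq_maxr n n') En'.
by exists (maxn n n') => //; exists (F `&` F'); split => //; exact: measurableI.
Qed.

Lemma measurable_increment_systems : increment_systems `<=` measurable.
Proof.
move=> _ [n _ [F [mF ->]]].
rewrite -[X in measurable X]setTI.
have := measurable_family (@measurable_increment R k t Q n).
exact.
Qed.

Let WG := g_sigma_algebraType increment_systems.

Let measurable_increment_WG n p :
  measurable_fun setT (increment n p : WG -> R).
Proof.
move=> _ A mA; rewrite setTI; apply: sub_sigma_algebra; exists n => //.
exists ((fun h : family_space IK R => h p) @^-1` A); split=> //.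
by rewrite -[X in measurable X]setTI; exact: measurable_eval.
Qed.

Let path_sum n i (j : 'I_k) y :
  path_at (msh n i) y ord0 j = \sum_(l < i) increment n (nat_of_ord l, j) y.
Proof.
elim: i => [|i IH].
  rewrite big_ord0 /path_at (proj2 (svalP y)) ?mxE//.
  by rewrite /mesh mul0r.
by rewrite big_ord_recr/= -IH /increment/= addrC subrK.
Qed.

Let mesh_cvg (u : R) : 0 <= u ->
  msh n (truncn (u / step n)) @[n --> \oo] --> u.
Proof.
move=> u0.
have bnd n : u - step n <= msh n (truncn (u / step n)) <= u.
  have s0 := mesh_step_gt0 t_gt0 Q_gt0 n.
  have us0 : 0 <= u / step n by rewrite divr_ge0// ltW.
  apply/andP; split; last by rewrite /mesh -ler_pdivlMr// truncn_le.
  rewrite lerBlDr /mesh -[X in _ + X]mul1r -mulrDl natr1 -ler_pdivrMr//.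
  by rewrite ltW// truncnS_gt.
apply: (@squeeze_cvgr _ _ _ _ (fun n => u - step n) (cst u)).
- by apply: nearW.
- rewrite -[X in _ --> X]subr0; apply: cvgB; first exact: cvg_cst.
  rewrite /mesh_step -[X in _ --> X](mulr0 eps); apply: cvgM; first exact: cvg_cst.
  under eq_fun do rewrite natrX -exprVn.
  by apply: cvg_expr; rewrite ger0_norm ?invr_ge0// invf_lt1 ?ltr1n.
- exact: cvg_cst.
Qed.

Lemma wiener_measurableE : (@measurable _ W) = <<s increment_systems >>.
Proof.
apply/seteqP; split; last first.
  apply: smallest_sub; first exact: sigma_algebra_measurable.
  exact: measurable_increment_systems.
apply: smallest_sub; first exact: smallest_sigma_algebra.
move=> _ [u _ [A mA <-]].
suff : measurable_fun setT (path_at u : WG -> 'rV[R]_k) by exact.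
apply/measurable_fun_rVP => j; have [u0|u0] := leP u 0.
  rewrite (_ : (fun _ => _) = cst 0); first exact: measurable_cst.
  by apply/funext => y; rewrite /path_at (proj2 (svalP y))// mxE.
apply: (@measurable_fun_cvg _ WG _ setT
  (fun n y => path_at (msh n (truncn (u / step n))) y ord0 j)) => //.
  move=> n; under eq_fun do rewrite path_sum.
  by apply: measurable_sum => l; exact: measurable_increment_WG.
move=> y _.
have cy : continuous (sval y) := proj1 (svalP y).
apply: (@cvg_comp _ _ _ (fun n => sval y (msh n (truncn (u / step n))))
  (fun x : 'rV[R]_k => x ord0 j) _ (nbhs (sval y u))).
  by apply: (cvg_comp _ _ (mesh_cvg (ltW u0))); exact: cy.
exact: coord_continuous.
Qed.

Variable mu : probability W R.
Hypothesis mu_wiener : wiener_measure mu.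

Let mesh_indices n := [seq (i, j) | i <- iota 0 (Q * 2 ^ n), j <- enum 'I_k].

Let law_increment n p : forall A, measurable A ->
  mu (increment n p @^-1` A) = normal_prob 0 (Num.sqrt (step n)) A.
Proof.
move=> A mA; have [_ _ _ _ /(_ (msh n p.1) (msh n p.1.+1) p.2 A)] := mu_wiener.
rewrite meshS addrAC subrr add0r => <- //; first by rewrite /increment meshS.
  by rewrite mulr_ge0// ltW// mesh_step_gt0.
by rewrite ltrDl mesh_step_gt0.
Qed.

Variable v : 'rV[R]_k.
Local Notation shift := (@wiener_shift R k t Q t_gt0 Q_gt0).

(** The density of the law of the shifted path; it only depends on the
    increment of the path over the interval on which the ramp rises. *)
Definition cameron_martin (y : W) : R := \prod_(j < k)
  gaussian_tilt eps (v ord0 j) (path_at t y ord0 j - path_at (t - eps) y ord0 j).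

Lemma cameron_martin_gt0 y : 0 < cameron_martin y.
Proof. by apply: prodr_gt0 => j _; exact: expR_gt0. Qed.

Lemma measurable_cameron_martin : measurable_fun setT cameron_martin.
Proof.
apply: measurable_prod => j _.
apply: (measurableT_comp (measurable_gaussian_tilt _ _)).
by apply: measurable_funB; exact: measurable_path_coord.
Qed.

Let tilt_exponent (a e s x : R) : e != 0 -> s != 0 ->
  s / e * a * x / s - (s / e * a) ^+ 2 / (s *+ 2) =
  a / e * x - a ^+ 2 / (e ^+ 2 *+ 2) * s.
Proof. by move=> e0 s0; field; rewrite e0 s0. Qed.

Let tilt_variance (a e : R) : e != 0 ->
  a ^+ 2 / (e *+ 2) = a ^+ 2 / (e ^+ 2 *+ 2) * e.
Proof. by move=> e0; field. Qed.

(* The Gaussian tilts of the increments along a mesh multiply to the same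
   function for every mesh: the exponents vanish off the ramp and telescope on
   it, where the ramp grows by the same amount at each step. *)
Let cameron_martin_mesh n y : cameron_martin y =
  \prod_(p <- mesh_indices n) gaussian_tilt (step n)
    (ramp_increment t Q n p.1 * v ord0 p.2) (increment n p y).
Proof.
have e0 : eps != 0 by rewrite gt_eqF// ramp_len_gt0.
have s0 : step n != 0 by rewrite gt_eqF// mesh_step_gt0.
rewrite big_allpairs_dep exchange_big/= /cameron_martin big_enum/=.
apply: eq_bigr => j _; rewrite -[RHS]expR_sum; congr expR.
rewrite -[X in iota 0 X]subn0 -/(index_iota 0 (Q * 2 ^ n)).
rewrite (big_cat_nat (n := Q.-1 * 2 ^ n))//=; last first.
  by rewrite leq_mul2r leq_pred orbT.
rewrite [X in _ = X + _]big1_seq ?add0r; last first.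
  move=> i /andP[_]; rewrite mem_index_iota => /andP[_ ib].
  by rewrite ramp_incrementE// leqNgt ib/= !mul0r expr0n/= !mul0r subrr.
under eq_big_nat => i bi.
  rewrite ramp_incrementE// bi.
  rewrite tilt_exponent//.
  over.
rewrite sumrB -mulr_sumr sumr_const_nat /increment/=.
rewrite (telescope_sumr (fun i => path_at (msh n i) y ord0 j)); last first.
  by rewrite leq_mul2r leq_pred orbT.
rewrite mesh_end// mesh_start//; congr (_ - _); first by rewrite mulrAC.
rewrite -mulnBl -[X in (X - _)%N](prednK Q_gt0) subSnn mul1n.
rewrite -[X in _ = X]mulr_natr -mulrA [step n * _]mulrC.
have -> : (2 ^ n)%:R * step n = eps.
  by rewrite /mesh_step mulrC divfK// pnatr_eq0 -lt0n expn_gt0.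
exact: tilt_variance.
Qed.

(** Cameron--Martin theorem for the ramp. On an event of the pi-system, the
    increments along one mesh are independent Gaussian variables, and each is
    translated by a constant. *)
Lemma wiener_shift_law (E : set W) : measurable E ->
  mu [set y | E (shift y v)] = (\int[mu]_y (cameron_martin y * \1_E y)%:E)%E.
Proof.
move=> mE.
have mid : measurable_fun setT (id : W -> W) by [].
have [m [mE' _]] := weighting_measure mu mid measurable_cameron_martin
  (fun y => ltW (cameron_martin_gt0 y)).
rewrite -(mE' _ mE).
have mshift := @measurable_wiener_shift R k t Q t_gt0 Q_gt0 v.
pose m1 : {measure set W -> \bar R} :=
  measure_function_pushforward__canonical__measure_function_Measure mu mshift.
rewrite [LHS](_ : _ = m1 E)//.
apply: (@measure_unique _ _ W increment_systems (fun=> setT) _ _ _ _ m1 m) => //.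
- exact: wiener_measurableE.
- exact: setI_closed_increment_systems.
- by move=> _; exists 0%N => //; exists setT; split.
- by rewrite bigcup_const//; exists 0%N.
- move=> _ [n _ [F [mF ->]]].
  have mFE : measurable [set y : W | F (fun p => increment n p y)].
    by apply: measurable_increment_systems; exists n => //; exists F.
  rewrite mE'// /m1 /= /pushforward/=.
  have [_ _ _ /(_ _ (mesh_time t_gt0 Q_gt0 n)) indep _] := mu_wiener.
  pose a p := ramp_increment t Q n p.1 * v ord0 p.2.
  have s0 : step n != 0 by rewrite gt_eqF// mesh_step_gt0.
  rewrite [X in mu X](_ : _ = [set y | F (fun p => increment n p y + a p)]);
    last first.
    have e y : (fun p => increment n p (shift y v)) =
        (fun p => increment n p y + a p).
      by apply/funext => p; rewrite increment_shift.
    by apply/seteqP; split=> y /=; rewrite e.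
  rewrite (@independent_change_of_law _ W _ _ _ mu IK (increment n)
    (fun p (x : R) => x + a p) (fun p => gaussian_tilt (step n) (a p))
    (mesh_indices n) (@measurable_increment R k t Q n) indep)//.
  + by apply: eq_integral => y _; rewrite (cameron_martin_mesh n).
  + by move=> p; exact: measurable_funD.
  + by move=> p; exact: measurable_gaussian_tilt.
  + by move=> p x; exact: gaussian_tilt_ge0.
  + by apply: allpairs_uniq => //; [exact: iota_uniq|exact: enum_uniq|move=> [? ?] [? ?]].
  + move=> [i j] x hp; rewrite /a ramp_incrementE//= ifF.
      by rewrite mul0r /gaussian_tilt !mul0r expr0n/= mul0r subrr expR0.
    apply/negbTE; apply: contra hp => /andP[_ ie]; apply/allpairsP.
    by exists (i, j); split; rewrite ?mem_iota ?mem_enum.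
  + move=> p A mA; rewrite law_increment//; last first.
      by rewrite -[X in measurable X]setTI; exact: measurable_funD.
    rewrite normal_prob_shift//; last by rewrite gt_eqF// sqrtr_gt0 mesh_step_gt0.
    rewrite sqr_sqrtr ?ltW ?mesh_step_gt0//.
    have mD : measurable_fun setT (increment n p : W -> measurableTypeR R).
      exact: (@measurable_increment R k t Q n p).
    rewrite (@eq_measure_integral _ _ _ setT
      (measure_function_pushforward__canonical__measure_function_Measure mu mD)
      (normal_prob 0 (Num.sqrt (step n)))); last first.
      by move=> C mC _; exact/esym/law_increment.
    rewrite ge0_integral_pushforward//=.
    - by apply/measurable_EFinP/measurable_funM => //; exact: measurable_gaussian_tilt.
    - by move=> x _; rewrite lee_fin mulr_ge0// gaussian_tilt_ge0.
- by move=> _; rewrite /m1 /= /pushforward preimage_setT probability_setT ltry.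
Qed.

End cameron_martin.

(** * Dependence of the solution on the shift *)

Section gronwall.
Context {R : realType}.
Local Notation leb := (@lebesgue_measure R).
Implicit Types (D : R -> R) (a b u L alpha : R).

Let primitive D u : R := \int[leb]_(x in `[0, u]) D x.

Lemma continuous_integrable_itv D a b : continuous D ->
  leb.-integrable `[a, b] (EFin \o D).
Proof.
move=> cD; apply: continuous_compact_integrable; first exact: segment_compact.
exact: continuous_subspaceT.
Qed.

(** The derivative of [expR (- L * u) * primitive D u] is at most [alpha]. *)
Lemma gronwall_step D L alpha a b : continuous D -> 0 <= a -> a <= b ->
  0 <= L -> 0 <= alpha ->
  (forall u, a <= u <= b -> D u <= alpha + L * primitive D u) ->
  expR (- L * b) * primitive D b <=
  expR (- L * a) * primitive D a + alpha * (b - a).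
Proof.
move=> cD a0 ab L0 alpha0 HD.
pose J := (fun u => expR (- L * u)) * primitive D.
pose dJ u := expR (- L * u) * (D u - L * primitive D u).
have dI u : 0 < u -> is_derive u 1 (primitive D) (D u).
  move=> u0; have [|dI <-] := @continuous_FTC1_closed R D 0 u (u + 1) _
    (continuous_integrable_itv _ _ cD) u0 (cD u); first by rewrite ltrDl.
  by rewrite derive1E; exact: DeriveDef.
have dJE u : u \in `]a, b[ -> is_derive u 1 J (dJ u).
  rewrite in_itv/= => /andP[au _].
  have u0 : 0 < u by exact: le_lt_trans au.
  have dIu := dI _ u0.
  have de : is_derive u 1 (fun u => expR (- L * u)) (- L * expR (- L * u)).
    have dl : is_derive u (1 : R) (fun u => - L * u) (- L).
      by apply: is_derive_eq; rewrite /GRing.scale/= mulr1.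
    have := is_derive1_comp (is_derive_expR (- L * u)) dl.
    by rewrite mulrC.
  apply: is_derive_eq.
  rewrite /dJ /GRing.scale/=; ring.
have cJ : {within `[a, b], continuous J}.
  move=> x; apply: cvgM.
    suff : {within `[a, b], continuous (fun u => expR (- L * u))} by apply.
    apply: continuous_subspaceT => y.
    apply: (@continuous_comp _ _ _ (fun u => - L * u) expR).
      by apply: cvgM; [exact: cvg_cst|exact: cvg_id].
    exact: continuous_expR.
  suff : {within `[a, b], continuous (primitive D)} by apply.
  apply: (@continuous_subspaceW _ _ _ `[0, b]%classic).
    by move=> y /=; rewrite !in_itv/= => /andP[/(le_trans a0) -> ->].
  apply: parameterized_integral_continuous; first exact: le_trans ab.
  exact: continuous_integrable_itv.
have [c cab] := MVT_segment ab dJE cJ.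
move=> /eqP; rewrite subr_eq addrC => /eqP Jb.
rewrite -[leLHS]/(J b) -[X in X + _]/(J a) Jb lerD2l ler_wpM2r ?subr_ge0//.
rewrite in_itv/= in cab.
have c0 : 0 <= c by move: cab => /andP[/(le_trans a0)].
rewrite -[leRHS]mul1r /dJ (@le_trans _ _ (expR (- L * c) * alpha))//.
  by rewrite ler_wpM2l ?expR_ge0// lerBlDr HD.
by rewrite ler_wpM2r// -expR0 ler_expR mulNr oppr_le0 mulr_ge0.
Qed.

(** Gronwall's inequality for a perturbation that acts only on the last part
    [[t - e, t]] of the interval: the accumulated effect is of order [e]. *)
Lemma gronwall_late D L alpha e t : continuous D -> 0 <= e <= t ->
  0 <= L -> 0 <= alpha ->
  (forall u, 0 <= u <= t - e -> D u <= L * primitive D u) ->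
  (forall u, 0 <= u <= t -> D u <= alpha + L * primitive D u) ->
  \int[leb]_(x in `[0, t]) D x <= expR (L * t) * alpha * e.
Proof.
move=> cD /andP[e0 et] L0 alpha0 H1 H2.
have te0 : 0 <= t - e by rewrite subr_ge0.
have tet : t - e <= t by rewrite gerBl.
have /= s1 := @gronwall_step D L 0 0 (t - e) cD (lexx _) te0 L0 (lexx _) _.
have /= s2 := @gronwall_step D L alpha (t - e) t cD te0 tet L0 alpha0 _.
have {}s1 : expR (- L * (t - e)) * primitive D (t - e) <= 0.
  rewrite (le_trans (s1 _))// => [u hu|]; first by rewrite add0r H1.
  by rewrite mul0r addr0 /primitive set_itv1 Rintegral_set1 mulr0.
have {}s2 : expR (- L * t) * primitive D t <= alpha * e.
  rewrite (le_trans (s2 _))// => [u /andP[h1 h2]|].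
    by rewrite H2// h2 (le_trans te0).
  by rewrite (_ : t - (t - e) = e) ?gerDr//; ring.
rewrite -[leLHS]mul1r -(expRxMexpNx_1 (L * t)) -!mulrA ler_pM2l ?expR_gt0//.
by rewrite -mulNr.
Qed.

End gronwall.

Section row_norm.
Context {R : realType} {m : nat}.
Implicit Types (M : 'rV[R]_m) (c : R).

Lemma rV_norm_le M c : 0 <= c -> (forall i, `|M ord0 i| <= c) -> `|M| <= c.
Proof.
move=> c0 Mc; rewrite /Num.norm/= mx_normrE; apply: bigmax_le => // -[i j] _ /=.
by rewrite ord1.
Qed.

Lemma rV_coord_le_norm M i : `|M ord0 i| <= `|M|.
Proof.
rewrite [leRHS]/Num.norm/= mx_normrE.
exact: (le_bigmax _ (fun ij : 'I_1 * 'I_m => `|M ij.1 ij.2|) (ord0, i)).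
Qed.

End row_norm.

Section solution_shift.
Context {R : realType} {m k : nat}.
Local Notation V := 'rV[R]_m.
Local Notation leb := (@lebesgue_measure R).
Variables (A : 'I_k -> V -> V) (B : V -> V -> V).
Variables (X : R -> V -> wiener_space R k -> V).
Hypothesis X_solution : solution A B X.
Variables (t : R) (t_gt0 : 0 < t) (x : V).
Hypothesis B_lipschitz : [lipschitz B z x | z in setT].

Let lip : exists2 L, 0 <= L & forall z z', `|B z x - B z' x| <= L * `|z - z'|.
Proof.
near (pinfty_nbhs R) => L; exists L => // z z'.
suff : L.-lipschitz_on (B ^~ x) (globally (setT `*` setT)) by move/(_ (z, z')); apply.
near: L; exact: B_lipschitz.
Unshelve. all: by end_near. Qed.

(* Constant for negative times, hence continuous on the whole line. *)
Let traj y u := X (maxr 0 u) x y.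

Let traj_continuous y : continuous (traj y).
Proof.
have [cX _] := X_solution x y.
have cmax : continuous (fun u : R => maxr 0 u).
  move=> u; have h : {for u, continuous ((fun=> 0) \max (id : R -> R^o))}.
    by apply: continuous_max; [exact: cvg_cst|exact: cvg_id].
  exact: h.
move=> u U hU.
have m0 w : `[0, +oo[%classic (maxr (0 : R) w).
  by rewrite /= in_itv/= andbT le_max lexx.
have h := (@subspace_continuousP _ _ _ _).1 cX _ (m0 u) U hU.
have hu := cmax u _ h.
apply: (@filterS _ (nbhs u) _ _ _ _ hu) => w hw; exact: (hw (m0 w)).
Qed.

Let B_continuous : continuous (B ^~ x).
Proof.
have [L L0 BL] := lip.
move=> z; apply/(@cvgrPdist_le _ _ _ (nbhs z)) => e e0.
have L1 : 0 < L + 1 by rewrite ltr_wpDl.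
have hz : \forall z' \near nbhs z, `|z - z'| <= e / (L + 1).
  apply: (@cvgr_dist_le _ _ _ (nbhs z) _ id z); first exact: cvg_id.
  by rewrite divr_gt0.
apply: (@filterS _ (nbhs z) _ _ _ _ hz) => z' hz'; rewrite (le_trans (BL _ _))//.
rewrite (@le_trans _ _ ((L + 1) * `|z - z'|))// ?ler_wpM2r ?lerDl//.
by rewrite mulrC -ler_pdivlMr.
Qed.

Let drift_continuous y i : continuous (fun u => B (traj y u) x ord0 i).
Proof.
move=> u; apply: (@continuous_comp _ _ _ (fun u => B (traj y u) x) (fun M : V => M ord0 i)).
  by apply: (@continuous_comp _ _ _ (traj y) (B ^~ x));
    [exact: traj_continuous|exact: B_continuous].
exact: coord_continuous.
Qed.

Let trajE y u : 0 <= u -> traj y u = x + \sum_j path_at u y ord0 j *: A j x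
  + \row_i \int[leb]_(v in `[0, u]) B (traj y v) x ord0 i.
Proof.
move=> u0; rewrite {1}/traj max_r// (X_solution x y).2//; congr (_ + _).
apply/rowP => i; rewrite !mxE; apply: eq_Rintegral => v.
by rewrite inE/= in_itv/= => /andP[v0 _]; rewrite /traj max_r.
Qed.

Definition noise_size : R := \sum_j `|A j x|.

(** Since the noise is additive, shifting the path by [ramp u *: v] moves the
    solution at time [t] by [v] applied to the vectors [A j x], up to the effect
    of the drift. The trajectories only differ on the final interval, of length
    [ramp_len t Q], so that this effect is small compared with [v - v']. The
    constant does not depend on the path nor on the length of the interval. *)
Lemma solution_shift : exists2 C, 0 <= C &
  forall Q (Q_gt0 : (0 < Q)%N) y v v',
  `|X t x (wiener_shift t_gt0 Q_gt0 y v) - X t x (wiener_shift t_gt0 Q_gt0 y v')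
    - \sum_j (v - v') ord0 j *: A j x| <= C * ramp_len t Q * `|v - v'|.
Proof.
have [L L0 BL] := lip.
have ns0 : 0 <= noise_size by apply: sumr_ge0.
exists (L * expR (L * t) * noise_size).
  by rewrite !mulr_ge0// expR_ge0.
move=> Q Q_gt0 y v v'.
set y1 := wiener_shift _ _ _ v; set y2 := wiener_shift _ _ _ v'.
set a := \sum_j _.
pose D u := `|traj y1 u - traj y2 u|.
pose I u := \int[leb]_(w in `[0, u]) D w.
have cD : continuous D.
  move=> u; apply: cvg_norm; apply: cvgB; exact: traj_continuous.
have a_le : `|a| <= noise_size * `|v - v'|.
  rewrite (le_trans (ler_norm_sum _ _ _))// /noise_size mulr_suml ler_sum// => j _.
  by rewrite normrZ mulrC ler_wpM2l// rV_coord_le_norm.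
have I0 u : 0 <= I u by apply: Rintegral_ge0 => w _; rewrite /D.
have main u : 0 <= u -> `|traj y1 u - traj y2 u - ramp t Q u *: a| <= L * I u.
  move=> u0; rewrite !trajE//.
  set n1 := \sum_j _; set n2 := \sum_j _; set b1 := \row_i _; set b2 := \row_i _.
  have -> : x + n1 + b1 - (x + n2 + b2) - ramp t Q u *: a = b1 - b2.
    suff -> : n1 = n2 + ramp t Q u *: a.
      apply/rowP => i; rewrite !mxE; ring.
    rewrite /n1 /n2 /a scaler_sumr -big_split/=; apply: eq_bigr => j _.
    rewrite scalerA -scalerDl; congr (_ *: _).
    rewrite /y1 /y2 !mxE; ring.
  apply: rV_norm_le => [|i]; first by rewrite mulr_ge0.
  have iD y' : leb.-integrable `[0, u] (EFin \o (fun w => B (traj y' w) x ord0 i)).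
    by apply: continuous_integrable_itv; exact: drift_continuous.
  rewrite !mxE -RintegralB//.
  have cB : continuous (fun w => B (traj y1 w) x ord0 i - B (traj y2 w) x ord0 i).
    by move=> w; apply: cvgB; exact: drift_continuous.
  rewrite (le_trans (le_normr_Rintegral _ _))//.
    exact: continuous_integrable_itv.
  rewrite /I -RintegralZl//; last exact: continuous_integrable_itv.
  apply: le_Rintegral => //.
  - apply: continuous_integrable_itv => w; apply: cvg_norm; exact: cB.
  - apply: continuous_integrable_itv => w; apply: cvgM; [exact: cvg_cst|exact: cD].
  move=> w _; rewrite (le_trans _ (BL _ _))//.
  by have := rV_coord_le_norm (B (traj y1 w) x - B (traj y2 w) x) i; rewrite !mxE.
have Dle u : 0 <= u -> D u <= ramp t Q u * `|a| + L * I u.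
  move=> u0; rewrite -lerBlDl (le_trans _ (main u u0))//.
  rewrite -[X in X * `|a|]ger0_norm ?ramp_ge0// -normrZ.
  exact: lerB_dist.
have It : I t <= expR (L * t) * `|a| * ramp_len t Q.
  apply: gronwall_late => //.
  - by rewrite ltW ?ramp_len_gt0// ramp_len_le.
  - move=> u /andP[u0 ut]; rewrite (le_trans (Dle _ u0))// ramp_le//.
    by rewrite mul0r add0r.
  - move=> u /andP[u0 ut]; rewrite (le_trans (Dle _ u0))// lerD2r.
    by rewrite ler_piMl// ramp_le1.
have := main t (ltW t_gt0); rewrite ramp_ge// scale1r /traj (max_r (ltW t_gt0)).
move/le_trans; apply.
rewrite (le_trans (ler_wpM2l L0 It))//.
rewrite [leLHS](_ : _ = L * expR (L * t) * ramp_len t Q * `|a|); last by ring.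
rewrite [leRHS](_ : _ = L * expR (L * t) * ramp_len t Q * (noise_size * `|v - v'|)); last by ring.
by rewrite ler_wpM2l// !mulr_ge0 ?expR_ge0// ltW// ramp_len_gt0.
Qed.

End solution_shift.

(** * Null sets under expanding maps *)

Section measure_le_algebra.
Context d (T : measurableType d) (R : realType).
Variables (m1 m2 : {measure set T -> \bar R}) (G : set_system T).
Local Open Scope ereal_scope.

(** Monotone class theorem for inequalities. A pi-system would not be enough:
    the sets on which one measure is below another are not stable under proper
    differences. *)
Lemma measure_le_algebra : setring G -> G setT -> G `<=` measurable ->
  m1 setT < +oo -> m2 setT < +oo ->
  (forall A, G A -> m1 A <= m2 A) -> forall A, <<s G >> A -> m1 A <= m2 A.
Proof.
move=> rG GT Gm m1oo m2oo m12.
have fin (m : {measure set T -> \bar R}) A : m setT < +oo -> measurable A -> m A < +oo.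
  by move=> moo mA; apply: le_lt_trans moo; apply: le_measure; rewrite ?inE.
pose C : set_system T := [set A | measurable A /\ m1 A <= m2 A].
have mC : monotone C.
  split=> F Fmon FC.
  - have mF i : measurable (F i) by have [] := FC i.
    have mU : measurable (\bigcup_i F i) by exact: bigcup_measurable.
    split=> //.
    apply: (lee_cvg_to (nondecreasing_cvg_mu (mu := m1) mF mU Fmon)
      (nondecreasing_cvg_mu (mu := m2) mF mU Fmon)).
    by apply: nearW => n; have [] := FC n.
  - have mF i : measurable (F i) by have [] := FC i.
    have mI : measurable (\bigcap_i F i) by exact: bigcapT_measurable.
    split=> //.
    have F0 (m : {measure set T -> \bar R}) : m setT < +oo -> m (F 0%N) < +oo.
      by move=> moo; exact: fin.
    apply: (lee_cvg_to (nonincreasing_cvg_mu (F0 _ m1oo) mF mI Fmon)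
      (nonincreasing_cvg_mu (F0 _ m2oo) mF mI Fmon)).
    by apply: nearW => n; have [] := FC n.
have GC : G `<=` C by move=> A GA; split; [exact: Gm|exact: m12].
have srC := monotone_setring_sub_g_sigma_ring mC rG GC.
move=> A sA; suff /srC[] : <<sr G >> A by [].
move: A sA; apply: smallest_sub; last exact: sub_smallest.
have [h0 hD hU] := smallest_sigma_ring G.
split=> // A GA; apply: hD => //.
by apply: sub_g_sigma_ring.
Qed.

End measure_le_algebra.

Section lebesgue_box.
Context {R : realType}.
Local Open Scope ereal_scope.

Definition box m (I : 'I_m -> set R) : set 'rV[R]_m :=
  [set x | forall i, I i (x ord0 i)].

Lemma measurable_box m (I : 'I_m -> set R) :
  (forall i, measurable (I i)) -> measurable (box I).
Proof.
move=> mI; rewrite (_ : box I = \bigcap_(i in [set: 'I_m]) (rV_coord i @^-1` I i)).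
  apply: fin_bigcap_measurable => // i _.
  by rewrite -[X in measurable X]setTI; exact: measurable_rV_coord.
by apply/seteqP; split=> [x h i _|x h i]; exact: h.
Qed.

Lemma lebesgue_rV_box m (I : 'I_m -> set R) : (forall i, measurable (I i)) ->
  lebesgue_rV (box I) = \prod_i lebesgue_measure (I i).
Proof.
elim: m I => [|m IH] I mI.
  rewrite big_ord0 /= diracE mem_set//.
  by move=> -[].
rewrite big_ord_recl -(IH (fun i => I (lift ord0 i)))// /= /pushforward.
rewrite (_ : _ @^-1` _ = I ord0 `*` box (fun i => I (lift ord0 i))).
  rewrite product_measure1E; [by []|exact: mI|].
  exact: (@measurable_box m (fun i => I (lift ord0 i)) (fun i => mI (lift ord0 i))).
have cons0 (p : measurableTypeR R * 'rV[R]_m) : rV_cons p ord0 ord0 = p.1.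
  by rewrite -[in RHS](rV_consK p).
have consS (p : measurableTypeR R * 'rV[R]_m) i :
    rV_cons p ord0 (lift ord0 i) = p.2 ord0 i.
  have -> : lift ord0 i = rshift 1 (i : 'I_m) :> 'I_(1 + m) by exact/val_inj.
  exact: row_mxEr.
apply/seteqP; split=> [p h|p [h1 h2] i].
  split=> [|i]; first by rewrite -cons0; exact: h.
  by rewrite -consS; exact: h.
have [j ->|->] := unliftP ord0 i; last by rewrite cons0.
by rewrite consS; exact: h2.
Qed.

End lebesgue_box.

Section dyadic.
Context {R : realType} {m : nat}.
Local Notation V := 'rV[R]_m.
Local Notation Z := {ffun 'I_m -> int}.

(** The index of the dyadic cube of side [2 ^- n] that contains [x]. *)
Definition dyadic_index n (x : V) : Z :=
  [ffun i => Num.floor (2 ^+ n * x ord0 i)].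

Definition dyadic_cube n (z : Z) : set V := [set x | dyadic_index n x = z].

(** Arbitrary unions of dyadic cubes of one side length: a ring of sets, by
    passing to the smaller of two side lengths, to which the comparison of
    measures on a generating ring applies. *)
Definition dyadic_sets : set_system V :=
  [set E | exists n (S : set Z), E = [set x | S (dyadic_index n x)]].

Let pow2_gt0 n : 0 < 2 ^+ n :> R.
Proof. by rewrite exprn_gt0. Qed.

Lemma dyadic_cubeE n z : dyadic_cube n z =
  box (fun i => `[(z i)%:~R / 2 ^+ n, (z i + 1)%:~R / 2 ^+ n[%classic).
Proof.
apply/seteqP; split=> x /=.
  move=> <- i; rewrite /= in_itv/= ffunE ler_pdivrMr// ltr_pdivlMr//.
  by rewrite [x _ _ * _]mulrC; exact: floor_itv.
move=> h; apply/ffunP => i; rewrite ffunE; apply: floor_def.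
have := h i; rewrite /= in_itv/= ler_pdivrMr// ltr_pdivlMr//.
by rewrite [x _ _ * _]mulrC.
Qed.

Lemma measurable_dyadic_cube n z : measurable (dyadic_cube n z).
Proof. by rewrite dyadic_cubeE; apply: measurable_box => i. Qed.

Lemma lebesgue_dyadic_cube n z :
  lebesgue_rV (dyadic_cube n z) = ((2 ^- n) ^+ m)%:E.
Proof.
rewrite dyadic_cubeE lebesgue_rV_box//.
under eq_bigr => i _.
  rewrite lebesgue_measure_itv/= lte_fin ltr_pM2r ?invr_gt0// ltr_int ltrDl ltr01.
  rewrite -EFinB -mulrBl intrD addrAC subrr add0r mul1r.
  over.
by rewrite prodEFin prodr_const card_ord.
Qed.

Let slice n (S : set Z) k : set V :=
  [set x | pickle (dyadic_index n x) = k /\ S (dyadic_index n x)].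

Let sliceE n S k : slice n S k = set0 \/ exists z, slice n S k = dyadic_cube n z.
Proof.
have [[x [xk Sx]]|h] := pselect (slice n S k !=set0); last first.
  by left; apply/seteqP; split=> x // ?; apply: h; exists x.
right; exists (dyadic_index n x); apply/seteqP; split=> y /=.
  by move=> [yk _]; apply: (pcan_inj pickleK); rewrite yk xk.
by move=> yx; rewrite /slice/= yx.
Qed.

Let measurable_slice n S k : measurable (slice n S k).
Proof. by have [->|[z ->]] := sliceE n S k; last exact: measurable_dyadic_cube. Qed.

Let slice_cover n (S : set Z) :
  [set x | S (dyadic_index n x)] = \bigcup_k slice n S k.
Proof.
apply/seteqP; split=> [x Sx|x [k _ []//]].
by exists (pickle (dyadic_index n x)).
Qed.

Lemma measurable_dyadic_sets : dyadic_sets `<=` measurable.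
Proof.
by move=> _ [n [S ->]]; rewrite slice_cover; exact: bigcup_measurable.
Qed.

Lemma dyadic_sets_refine n (S : set Z) n' : (n <= n')%N ->
  exists S' : set Z, [set x | S (dyadic_index n x)] =
                     [set x | S' (dyadic_index n' x)].
Proof.
elim: n' => [|n' IH]; first by rewrite leqn0 => /eqP ->; exists S.
rewrite leq_eqVlt => /predU1P[->|]; first by exists S.
rewrite ltnS => /IH[S' ->].
exists [set z | S' [ffun i => (z i %/ 2)%Z]].
suff e x : [ffun i => (dyadic_index n'.+1 x i %/ 2)%Z] = dyadic_index n' x.
  by apply/seteqP; split=> x /=; rewrite e.
apply/ffunP => i; rewrite !ffunE; apply/esym/floor_def.
set y := 2 ^+ n' * x ord0 i.
have -> : 2 ^+ n'.+1 * x ord0 i = 2 * y by rewrite exprS mulrA.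
have /andP[h1 h2] := floor_itv (2 * y).
set f := Num.floor (2 * y) in h1 h2 *.
have fE := divz_eq f 2; set q := (f %/ 2)%Z in fE *.
have r0 : (0 <= (f %% 2)%Z)%R by exact: modz_ge0.
have r2 : ((f %% 2)%Z < 2)%R by exact: ltz_pmod.
apply/andP; split.
  suff : 2 * (q%:~R : R) <= 2 * y by rewrite ler_pM2l.
  apply: le_trans h1; rewrite -[2]/(2%:~R : R) -intrM ler_int; lia.
suff : 2 * y < 2 * ((q + 1)%:~R : R) by rewrite ltr_pM2l.
apply: (lt_le_trans h2); rewrite -[2]/(2%:~R : R) -intrM ler_int; lia.
Qed.

Lemma setring_dyadic_sets : setring dyadic_sets.
Proof.
have common E E' : dyadic_sets E -> dyadic_sets E' -> exists n (S S' : set Z),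
    E = [set x | S (dyadic_index n x)] /\ E' = [set x | S' (dyadic_index n x)].
  move=> [n [S ->]] [n' [S' ->]].
  have [T ->] := dyadic_sets_refine S (leq_maxl n n').
  have [T' ->] := dyadic_sets_refine S' (leq_maxr n n').
  by exists (maxn n n'), T, T'.
split.
- by exists 0%N, set0.
- by move=> E E' /common h /h[n [S [S' [-> ->]]]]; exists n, (S `|` S').
- by move=> E E' /common h /h[n [S [S' [-> ->]]]]; exists n, (S `\` S').
Qed.

Lemma dyadic_sets_generate : (@measurable _ V) `<=` <<s dyadic_sets >>.
Proof.
pose VG := g_sigma_algebraType dyadic_sets.
suff h : measurable_fun setT (id : VG -> V).
  by move=> E mE; have := h measurableT _ mE; rewrite setTI.
apply/measurable_fun_rVP => i.
apply: (@measurable_fun_cvg _ VG _ setT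
  (fun n (x : V) => (dyadic_index n x i)%:~R / 2 ^+ n)) => //.
  move=> n _ Y mY; rewrite setTI; apply: sub_sigma_algebra.
  by exists n, [set z : Z | Y ((z i)%:~R / 2 ^+ n)].
move=> x _.
apply: (@squeeze_cvgr _ _ _ _ (fun n => x ord0 i - 2 ^- n) (cst (x ord0 i))).
- apply: nearW => n; rewrite ffunE ler_pdivrMr// [x _ _ * _]mulrC.
  have /andP[-> h2] := floor_itv (2 ^+ n * x ord0 i).
  rewrite andbT lerBlDr -[X in _ + X]mul1r -mulrDl ler_pdivlMr// mulrC ltW//.
  by move: h2; rewrite intrD.
- rewrite -[X in _ --> X]subr0; apply: cvgB; first exact: cvg_cst.
  under eq_fun do rewrite -exprVn.
  by apply: cvg_expr; rewrite ger0_norm ?invr_ge0// invf_lt1 ?ltr1n.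
- exact: cvg_cst.
Qed.

Lemma dyadic_cube_diam n z (x y : V) : dyadic_cube n z x -> dyadic_cube n z y ->
  `|x - y| <= 2 ^- n.
Proof.
rewrite dyadic_cubeE => hx hy; apply: rV_norm_le; first by rewrite invr_ge0 ltW.
move=> i; have := hx i; have := hy i; rewrite /= !in_itv/= !mxE intrD mulrDl mul1r.
by move=> /andP[h1 h2] /andP[h3 h4]; rewrite ler_norml; lra.
Qed.

(** A dyadic set is a countable disjoint union of cubes; the monotone class
    argument needs finite measures, hence is run inside each cube of side 1. *)
Lemma dyadic_dominated (rho : {measure set V -> \bar R}) (C : R) : 0 <= C ->
  (forall n z, (rho (dyadic_cube n z) <= (C * (2 ^- n) ^+ m)%:E)%E) ->
  forall E, measurable E -> (rho E <= C%:E * lebesgue_rV E)%E.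
Proof.
move=> C0 rho_cube.
pose leb : {measure set V -> \bar R} := @lebesgue_rV R m.
have slice_trivI n (S : set Z) (E : set V) : trivIset setT (fun j => E `&` slice n S j).
  by move=> i j _ _ [x [[_ [<- _]] [_ [<- _]]]].
have on_dyadic A : dyadic_sets A -> (rho A <= C%:E * leb A)%E.
  move=> [n [S ->]]; rewrite slice_cover.
  have tS : trivIset setT (slice n S).
    by move=> i j _ _ [x [[<- _] [<- _]]].
  rewrite !measure_bigcup//= -nneseriesZl//; apply: lee_nneseries => // k _.
  have [->|[z ->]] := sliceE n S k; first by rewrite !measure0 mule0.
  by rewrite (le_trans (rho_cube n z))// lebesgue_dyadic_cube.
have on_slice E k : measurable E ->
    (rho (E `&` slice 0 setT k) <= C%:E * leb (E `&` slice 0 setT k))%E.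
  move=> mE; have [->|[z ->]] := sliceE 0 setT k.
    by rewrite setI0 !measure0 mule0.
  have mc := measurable_dyadic_cube 0 z.
  pose m1 : {measure set V -> \bar R} := mrestr rho mc.
  pose m2 : {measure set V -> \bar R} := mscale (NngNum C0) (mrestr leb mc).
  have cube_dyadic : dyadic_sets (dyadic_cube 0 z) by exists 0%N, [set z].
  apply: (@measure_le_algebra _ V R m1 m2 dyadic_sets).
  - exact: setring_dyadic_sets.
  - by exists 0%N, setT.
  - exact: measurable_dyadic_sets.
  - rewrite /m1 /= /mrestr setTI (le_lt_trans (rho_cube 0%N z))// ltry//.
  - by rewrite /m2 /= /mscale/= /mrestr setTI lebesgue_dyadic_cube ltry.
  - move=> A dA; rewrite /m1 /m2 /= /mscale/= /mrestr; apply: on_dyadic.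
    have [_ _ hD] := setring_dyadic_sets.
    by rewrite -setDD; exact: hD dA (hD _ _ dA cube_dyadic).
  - exact: dyadic_sets_generate.
move=> E mE.
have EE : E = \bigcup_k (E `&` slice 0 setT k).
  by rewrite -setI_bigcupr -slice_cover setIT.
rewrite {1}EE measure_bigcup//=; last by move=> k _; exact: measurableI.
rewrite {2}EE measure_bigcup//=; last by move=> k _; exact: measurableI.
by rewrite -nneseriesZl//; apply: lee_nneseries => // k _; exact: on_slice.
Qed.

(** The preimage of a cube of side [2 ^- n] has diameter at most
    [2 ^- n / kappa], so that the image of Lebesgue measure under [f] is
    dominated by a multiple of Lebesgue measure. *)
Lemma expanding_null (f : V -> V) (kappa : R) : 0 < kappa ->
  measurable_fun setT f ->
  (forall x y, kappa * `|x - y| <= `|f x - f y|) ->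
  forall E, measurable E -> lebesgue_rV E = 0%E -> lebesgue_rV (f @^-1` E) = 0%E.
Proof.
move=> k0 mf fexp E mE E0.
pose rho : {measure set V -> \bar R} :=
  measure_function_pushforward__canonical__measure_function_Measure
    (@lebesgue_rV R m) mf.
have C0 : 0 <= (2 / kappa) ^+ m by rewrite exprn_ge0// divr_ge0// ltW.
have := @dyadic_dominated rho _ C0 _ E mE.
rewrite E0 mule0 => h; apply/eqP; rewrite eq_le measure_ge0 andbT; apply: h.
move=> n z; rewrite /rho /= /pushforward.
have [[x fx]|h] := pselect (f @^-1` dyadic_cube n z !=set0); last first.
  rewrite (_ : _ @^-1` _ = set0) ?measure0 ?lee_fin.
    by rewrite mulr_ge0// exprn_ge0// invr_ge0 ltW.
  by apply/seteqP; split=> x // hx; apply: h; exists x.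
pose r : R := 2 ^- n / kappa.
have r0 : 0 < r by rewrite divr_gt0// invr_gt0.
pose B := box (fun i => `[x ord0 i - r, x ord0 i + r]%classic).
have mB : measurable B by exact: measurable_box.
apply: (@le_trans _ _ (lebesgue_rV B)).
  apply: le_measure; rewrite ?inE//.
    rewrite -[X in measurable X]setTI.
    exact: (mf measurableT _ (measurable_dyadic_cube n z)).
  move=> y fy i; rewrite /= in_itv/=.
  have yx : `|y - x| <= r.
    rewrite ler_pdivlMr// mulrC (le_trans (fexp _ _))//.
    exact: dyadic_cube_diam fy fx.
  have := le_trans (rV_coord_le_norm (y - x) i) yx.
  by rewrite !mxE ler_norml => /andP[h1 h2]; lra.
rewrite lebesgue_rV_box//.
under eq_bigr => i _.
  rewrite lebesgue_measure_itv/= lte_fin ifT; last by lra.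
  rewrite -EFinB (_ : _ - _ = 2 * r); last by ring.
  over.
rewrite prodEFin prodr_const card_ord lee_fin -exprMn.
rewrite (_ : 2 / kappa / 2 ^+ n = 2 * r)// /r; ring.
Qed.

End dyadic.

(** * Limits of measurable sequences *)

Section measurable_lim.
Context d (T : measurableType d) {R : realType} {m : nat}.
Local Notation V := 'rV[R]_m.
Variable u : nat -> T -> V.
Hypothesis mu : forall n, measurable_fun setT (u n).

Lemma measurable_fun_norm_rV (f : T -> V) : measurable_fun setT f ->
  measurable_fun setT (fun w => `|f w|).
Proof.
move=> mf; under eq_fun do rewrite /Num.norm/= mx_normrE.
elim: (index_enum _) => [|ij r IH].
  by under eq_fun do rewrite big_nil; exact: measurable_cst.
under eq_fun do rewrite big_cons.
apply: measurable_maxr => //; apply: measurableT_comp => //; case: ij => i j /=.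
by rewrite ord1; exact: (measurable_fun_rVP _).1.
Qed.

Lemma measurable_norm_rV (f : T -> V) (e : R) : measurable_fun setT f -> 0 <= e ->
  measurable [set w | `|f w| <= e].
Proof.
move=> mf e0; rewrite -[X in measurable X]setTI.
rewrite (_ : [set _ | _] = (fun w => `|f w|) @^-1` `]-oo, e]%classic).
  exact: (measurable_fun_norm_rV mf).
by apply/seteqP; split=> w /=; rewrite in_itv.
Qed.

(** The Cauchy criterion with countably many quantifiers, which makes the set of
    convergence measurable. *)
Lemma cvg_seq_normP (v : nat -> V) : cvg (v n @[n --> \oo]) <->
  forall k, exists N, forall n, (N <= n)%N -> `|v n - v N| <= k.+1%:R^-1.
Proof.
split=> [/cvg_ex[l vl] k|h].
  have e0 : 0 < (k.+1%:R^-1 / 2 : R) by rewrite divr_gt0// invr_gt0 ltr0n.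
  move/cvgrPdist_le : vl => /(_ _ e0)[N _ Nv].
  exists N => n Nn; rewrite (splitr k.+1%:R^-1).
  rewrite (le_trans (ler_distD l _ _))// lerD//; last exact: (Nv N (leqnn N)).
  by rewrite distrC; exact: Nv.
apply/cauchy_cvgP/cauchy_exP => _/posnumP[e].
have [N Nv] := h (truncn e%:num^-1).
exists (v N); exists N => // n /= Nn; rewrite -ball_normE/= distrC.
rewrite (le_lt_trans (Nv _ Nn))// invf_plt ?posrE//.
exact: truncnS_gt.
Qed.

Lemma measurable_cvg_set : measurable [set w | cvg (u n w @[n --> \oo])].
Proof.
rewrite (_ : [set _ | _] = \bigcap_k \bigcup_N \bigcap_(n in [set n | (N <= n)%N])
    [set w | `|u n w - u N w| <= k.+1%:R^-1]).
  apply: bigcapT_measurable => k; apply: bigcupT_measurable => N.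
  apply: bigcap_measurable; first by exists N => /=.
  move=> n _; apply: measurable_norm_rV; last by rewrite invr_ge0.
  apply/measurable_fun_rVP => i.
  under eq_fun do rewrite !mxE.
  by apply: measurable_funB; exact: (measurable_fun_rVP _).1.
apply/seteqP; split=> w /=.
  by move=> /cvg_seq_normP h k _; have [N hN] := h k; exists N.
by move=> h; apply/cvg_seq_normP => k; have [N _ hN] := h k I; exists N.
Qed.

(** Where the sequence diverges the limit is the default point, a constant. *)
Lemma measurable_lim_rV : measurable_fun setT (fun w => lim (u n w @[n --> \oo])).
Proof.
set C := [set w | cvg (u n w @[n --> \oo])].
have mC : measurable C by exact: measurable_cvg_set.
apply/measurable_fun_rVP => i.
rewrite [X in measurable_fun _ X](_ : _ = (fun w => if w \in C
  then lim (u n w @[n --> \oo]) ord0 i else (point : V) ord0 i)); last first.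
  apply/funext => w; case: ifPn => // /negP nC.
  rewrite dvgP// => h; apply: nC; exact/mem_set.
have CE : (fun w => w \in C) @^-1` [set true] = C.
  by apply/seteqP; split=> w; [exact: set_mem|exact: mem_set].
apply: measurable_fun_if => //.
- by apply: (measurable_fun_bool true); rewrite setTI CE.
- rewrite setTI CE.
  apply: (@measurable_fun_cvg _ _ _ _ (fun n w => u n w ord0 i)).
    by move=> n; apply: measurable_funTS; exact: (measurable_fun_rVP _).1.
  move=> w Cw; apply: (@cvg_comp _ _ _ (u ^~ w) (fun x : V => x ord0 i) _
    (nbhs (lim (u n w @[n --> \oo])))); first exact: Cw.
  exact: coord_continuous.
Qed.

End measurable_lim.

(** * Null sets of shifted marks *)

Lemma integral_pos_eq0 d (T : measurableType d) (R : realType)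
    (mu : {measure set T -> \bar R}) (g : T -> R) (E : set T) :
  measurable_fun setT g -> (forall x, 0 < g x) -> measurable E ->
  (\int[mu]_x (g x * \1_E x)%:E = 0)%E -> mu E = 0%E.
Proof.
move=> mg g0 mE int0.
have mgE : measurable_fun setT (fun x => (g x * \1_E x)%:E).
  by apply/measurable_EFinP; apply: measurable_funM => //; exact: measurable_indic.
have : (\int[mu]_x `|(g x * \1_E x)%:E| = 0)%E.
  rewrite -int0; apply: eq_integral => x _; rewrite gee0_abs// lee_fin.
  by rewrite mulr_ge0// ltW.
move/(ae_eq_integral_abs mu measurableT mgE) => ae0.
apply: measure_negligible => //.
apply: negligibleS ae0 => x Ex /= h; have := h I.
by rewrite indicE mem_set// mulr1 => -[] /eqP; rewrite gt_eqF.
Qed.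

Section marks_shift.
Context {R : realType} {k : nat}.
Variables (t : R) (Q : nat) (t_gt0 : 0 < t) (Q_gt0 : (0 < Q)%N).
Local Notation W := (wiener_space R k).
Local Notation shift := (@wiener_shift R k t Q t_gt0 Q_gt0).
Variables (mu : probability W R) (mu_wiener : wiener_measure mu).
Context d (Omega : measurableType d) (P : probability Omega R).
Variable eta : nat -> Omega -> W.
Hypothesis meta : forall n, measurable_fun setT (eta n).
Hypothesis eta_law : forall n E, measurable E -> P (eta n @^-1` E) = mu E.
Hypothesis eta_indep : mutually_independent P eta.

(** The shifted marks have a positive density with respect to the original
    ones, so that both laws have the same null sets. *)
Lemma marks_shift_null (v : nat -> 'rV[R]_k) N (F : set (family_space nat W)) :
  (forall n, (N <= n)%N -> v n = 0) -> measurable F ->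
  P [set w | F (fun n => shift (eta n w) (v n))] = 0%E ->
  P [set w | F (fun n => eta n w)] = 0%E.
Proof.
move=> v0 mF.
pose z n y := cameron_martin t Q (v n) y.
have mz n : measurable_fun setT (z n) by exact: measurable_cameron_martin.
have z0 n y : 0 < z n y by exact: cameron_martin_gt0.
rewrite (@independent_change_of_law _ _ _ W _ P _ eta
  (fun n y => shift y (v n)) z (iota 0 N) meta eta_indep)//.
- move=> int0.
  apply: (@integral_pos_eq0 _ _ _ P (fun w => \prod_(n <- iota 0 N) z n (eta n w))).
  + by apply: measurable_prod => n _; exact: measurableT_comp.
  + by move=> w; apply: prodr_gt0.
  + by rewrite -[X in measurable X]setTI; exact: (measurable_family meta).
  + exact: int0.
- by move=> n; exact: measurable_wiener_shift.
- by move=> n y; exact: ltW.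
- exact: iota_uniq.
- move=> n y; rewrite mem_iota add0n /= -leqNgt => /v0 vn.
  rewrite /z vn /cameron_martin big1// => j _.
  by rewrite mxE /gaussian_tilt mul0r mul0r expr0n/= mul0r subrr expR0.
- move=> n E mE.
  rewrite eta_law; last first.
    by rewrite -[X in measurable X]setTI; exact: measurable_wiener_shift.
  rewrite (wiener_shift_law t_gt0 Q_gt0 mu_wiener)//.
  rewrite (@eq_measure_integral _ _ _ setT
    (measure_function_pushforward__canonical__measure_function_Measure P (meta n))
    mu); last by move=> C mC _; exact/esym/eta_law.
  rewrite ge0_integral_pushforward//.
  + by apply/measurable_EFinP; apply: measurable_funM => //; exact: mz.
  + by move=> y _; rewrite lee_fin mulr_ge0// ltW// z0.
Qed.

End marks_shift.

Lemma ae_finite_of_integral d (Omega : measurableType d) (R : realType)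
    (P : {measure set Omega -> \bar R}) (f : Omega -> \bar R) :
  measurable_fun setT f -> (forall w, 0 <= f w)%E -> (\int[P]_w f w < +oo)%E ->
  {ae P, forall w, (f w < +oo)%E}.
Proof.
move=> mf f0 foo.
have intf : P.-integrable setT f.
  apply/integrableP; split=> //; rewrite (eq_integral f)// => w _.
  by rewrite gee0_abs.
have := integrable_ae measurableT intf.
by apply: filterS => w /(_ I); rewrite ge0_fin_numE.
Qed.

(** * Summable jumps and spanning weights *)

Section summable.
Context {R : realType} {m : nat}.
Local Notation V := 'rV[R]_m.

Lemma summable_norm_cvg (b : nat -> R) : (forall n, 0 <= b n) ->
  (\sum_(0 <= n <oo) (b n)%:E < +oo)%E -> cvgn (series b).
Proof.
move=> b0 boo.
have tot0 : (0 <= \sum_(0 <= n <oo) (b n)%:E)%E.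
  by apply: nneseries_ge0 => n _ _; rewrite lee_fin.
apply: nondecreasing_is_cvgn.
  by apply/nondecreasing_seqP => n; rewrite /series/= big_nat_recr//= lerDl.
exists (fine (\sum_(0 <= n <oo) (b n)%:E)%E) => _ [n _ <-].
rewrite -lee_fin fineK ?ge0_fin_numE// /series/= -sumEFin.
by apply: nneseries_lim_ge => i _ _; rewrite lee_fin.
Qed.

(** All but finitely many terms have norm less than 1, and the truncation does
    not change these. *)
Lemma summable_min1_cvg (u : nat -> V) :
  (\sum_(0 <= n <oo) (minr `|u n| 1)%:E < +oo)%E -> cvgn (series u).
Proof.
move=> uoo; pose b n := minr `|u n| 1.
have b0 n : 0 <= b n by rewrite /b le_min normr_ge0 ler01.
have cb : cvgn (series b) by exact: summable_norm_cvg.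
have [N _ bN] : \forall n \near \oo, b n < 1.
  have /cvgr0_norm_lt/(_ _ ltr01) := cvg_series_cvg_0 cb.
  by apply: filterS => n; rewrite ger0_norm.
suff cn0 : cvgn (series (fun n => `|u n|)).
  have /cauchy_cvgP/cauchy_seriesP cn : cvgn [normed series u] := cn0.
  apply/cauchy_cvgP/cauchy_seriesP => e /cn.
  apply: filterS => n /=; rewrite ger0_norm ?sumr_ge0//.
  by apply: le_lt_trans; exact: ler_norm_sum.
apply: nondecreasing_is_cvgn.
  by apply/nondecreasing_seqP => n; rewrite /series/= big_nat_recr//= lerDl.
have [M Mb] : exists M, forall n, series b n <= M.
  exists (limn (series b)) => n; apply: nondecreasing_cvgn_le => //.
  by apply/nondecreasing_seqP => i; rewrite /series/= big_nat_recr//= lerDl.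
exists (\sum_(0 <= i < N) `|u i| + M) => _ [n _ <-].
apply: (@le_trans _ _ (\sum_(0 <= i < N) `|u i| + series b n)); last by rewrite lerD2l.
elim: n => [|n IH]; first by rewrite /series/= !big_nil addr0 sumr_ge0.
have [nN|Nn] := ltnP n N.
  rewrite (@le_trans _ _ (\sum_(0 <= i < N) `|u i|))//.
    rewrite /series/= [leRHS](big_cat_nat (n := n.+1))//= lerDl.
    by rewrite sumr_ge0.
  by rewrite lerDl /series/= sumr_ge0.
move: IH; rewrite /series/= !big_nat_recr//= addrA => IH.
rewrite lerD//; have /= := bN n Nn.
by rewrite /b gt_min ltxx orbF => h; rewrite le_min lexx ltW.
Qed.

End summable.

Section spanning_weights.
Context {R : realType} {m k : nat}.
Local Notation V := 'rV[R]_m.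
Variables (A : 'I_k -> V -> V) (x : nat -> V) (K : pred nat).
Hypothesis Kinf : forall N, exists2 n, (N <= n)%N & K n.
Hypothesis xn0 : forall n, K n -> x n != 0.
Hypothesis xsum : (\sum_(0 <= n <oo | K n) `|x n|%:E < +oo)%E.
Hypothesis Hspan : forall x : nat -> V, (forall n, x n != 0) ->
  x @ \oo --> (0 : V) ->
  span_has_dim [set A p.2 (x p.1) | p in [set: nat * 'I_k]] m.

Let combination (w : nat -> 'rV[R]_k) M : V :=
  \sum_(n < M) \sum_j w n ord0 j *: A j (x n).

(* A linear subspace that contains every [A j (x n)] with [K n]; the spanning
   hypothesis, applied to a subsequence of nonzero [x n] in [K], which tends to
   0 by summability, shows that it is the whole space. *)
Let reachable (v : V) := exists (w : nat -> 'rV[R]_k) N,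
  [/\ forall n, (N <= n)%N -> w n = 0, forall n, ~~ K n -> w n = 0 &
      forall M, (N <= M)%N -> combination w M = v].

Let reachable0 : reachable 0.
Proof.
exists (fun=> 0), 0%N; split=> // M _; rewrite /combination big1// => n _.
by rewrite big1// => j _; rewrite mxE scale0r.
Qed.

Let reachableD v v' : reachable v -> reachable v' -> reachable (v + v').
Proof.
move=> [w [N [wN wK wv]]] [w' [N' [wN' wK' wv']]].
exists (fun n => w n + w' n), (maxn N N'); split.
- by move=> n; rewrite geq_max => /andP[/wN -> /wN' ->]; rewrite addr0.
- by move=> n Kn; rewrite wK// wK'// addr0.
- move=> M; rewrite geq_max => /andP[/wv <- /wv' <-].
  rewrite /combination -big_split/=; apply: eq_bigr => n _.
  by rewrite -big_split/=; apply: eq_bigr => j _; rewrite mxE scalerDl.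
Qed.

Let reachableZ c v : reachable v -> reachable (c *: v).
Proof.
move=> [w [N [wN wK wv]]]; exists (fun n => c *: w n), N; split.
- by move=> n /wN ->; rewrite scaler0.
- by move=> n /wK ->; rewrite scaler0.
- move=> M /wv <-; rewrite /combination scaler_sumr; apply: eq_bigr => n _.
  by rewrite scaler_sumr; apply: eq_bigr => j _; rewrite mxE scalerA.
Qed.

Let reachableA n j : K n -> reachable (A j (x n)).
Proof.
move=> Kn; exists (fun i => if i == n then delta_mx ord0 j else 0), n.+1; split.
- by move=> i ni; rewrite gtn_eqF.
- by move=> i; case: eqP => [->|//]; rewrite Kn.
- move=> M nM; rewrite /combination (bigD1 (Ordinal nM))//= eqxx.
  rewrite (bigD1 j)//= mxE !eqxx scale1r big1 ?addr0; last first.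
    by move=> i ij; rewrite mxE (negbTE ij) andbF scale0r.
  rewrite big1 ?addr0// => i ni; rewrite ifF; last first.
    by apply: contraNF ni => /eqP ni; apply/eqP/val_inj.
  by rewrite big1// => l _; rewrite mxE scale0r.
Qed.

Let subsequence : exists2 f : nat -> nat, forall n, (n <= f n)%N &
  forall n, K (f n).
Proof.
have /choice[f fP] : forall n, exists i, (n <= i)%N /\ K i.
  by move=> n; have [i ni Ki] := Kinf n; exists i.
by exists f => n; have [] := fP n.
Qed.

Let all_reachable v : reachable v.
Proof.
have [f fge fK] := subsequence.
have xf0 : (fun n => x (f n)) @ \oo --> (0 : V).
  pose b n : R := if K n then `|x n| else 0.
  have cb : cvgn (series b).
    apply: summable_norm_cvg => [n|]; first by rewrite /b; case: ifP.
    rewrite (_ : (\sum_(0 <= n <oo) _)%E = (\sum_(0 <= n <oo | K n) `|x n|%:E)%E)//.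
    rewrite [RHS]eseries_mkcond; apply: eq_eseriesr => n _.
    by rewrite /b; case: ifP.
  have b_cvg0 := cvg_series_cvg_0 cb.
  apply/cvgr0Pnorm_lt => e e0.
  have [N _ Nb] : \forall n \near \oo, `|b n| < e by move/cvgr0Pnorm_lt : b_cvg0; apply.
  exists N => // n /= Nn; have := Nb (f n) (leq_trans Nn (fge n)).
  by rewrite /b fK normr_id.
have [U [spanU dimU]] := Hspan (fun n => xn0 (fK n)) xf0.
have Ufull : U = fullv.
  by apply/eqP; rewrite eqEdim subvf/= dimU dimvf /dim/= mul1n.
have : lin_span [set A p.2 (x (f p.1)) | p in [set: nat * 'I_k]] v.
  by rewrite spanU Ufull /= memvf.
move=> [n [c [g [gA ->]]]].
apply: big_ind => [|u u'|i _]; [exact: reachable0|exact: reachableD|].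
by apply: reachableZ; have [p _ <-] := gA i; exact: reachableA.
Qed.

(** Finitely many of the vectors [A j (x n)] span the space; row [i] of the
    matrices [w n] holds the coefficients of the [i]-th unit vector. *)
Lemma spanning_weights : exists N (w : nat -> 'M[R]_(m, k)),
  [/\ forall n, (N <= n)%N -> w n = 0, forall n, ~~ K n -> w n = 0 &
      forall h : V, \sum_(n < N) \sum_j (h *m w n) ord0 j *: A j (x n) = h].
Proof.
have /choice[wN wNP] : forall i : 'I_m, exists wN : (nat -> 'rV[R]_k) * nat,
    [/\ forall n, (wN.2 <= n)%N -> wN.1 n = 0, forall n, ~~ K n -> wN.1 n = 0 &
      forall M, (wN.2 <= M)%N -> combination wN.1 M = delta_mx ord0 i].
  by move=> i; have [w [N h]] := all_reachable (delta_mx ord0 i); exists (w, N).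
pose N := (\max_i (wN i).2)%N.
have leN i : ((wN i).2 <= N)%N by exact: leq_bigmax.
exists N, (fun n => \matrix_i (wN i).1 n); split=> [n Nn|n Kn|h].
- apply/matrixP => i j; rewrite !mxE; have [wn _ _] := wNP i.
  by rewrite wn ?mxE// (leq_trans (leN i)).
- apply/matrixP => i j; rewrite !mxE; have [_ wn _] := wNP i.
  by rewrite wn ?mxE.
rewrite [RHS]row_sum_delta.
transitivity (\sum_i h ord0 i *: combination (wN i).1 N); last first.
  by apply: eq_bigr => i _; have [_ _ ->] := wNP i.
rewrite /combination; under [RHS]eq_bigr do rewrite scaler_sumr.
rewrite [RHS]exchange_big/=; apply: eq_bigr => n _.
under [RHS]eq_bigr do rewrite scaler_sumr.
rewrite [RHS]exchange_big/=; apply: eq_bigr => j _.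
rewrite mxE scaler_suml; apply: eq_bigr => i _.
by rewrite !mxE scalerA.
Qed.

End spanning_weights.

(** * Random marks on fixed points *)

Section fixed_points.
Context {R : realType} {m k : nat}.
Local Notation V := 'rV[R]_m.
Local Notation W := (wiener_space R k).
Variables (mu : probability W R) (mu_wiener : wiener_measure mu).
Variables (A : 'I_k -> V -> V) (B : V -> V -> V) (X : R -> V -> W -> V).
Hypothesis B_lipschitz : forall x, [lipschitz B z x | z in setT].
Hypothesis X_solution : solution A B X.
Variables (t : R) (t_gt0 : 0 < t).
Hypothesis X_measurable : forall x, measurable_fun setT (X t x).
Hypothesis Hspan : forall x : nat -> V, (forall n, x n != 0) ->
  x @ \oo --> (0 : V) ->
  span_has_dim [set A p.2 (x p.1) | p in [set: nat * 'I_k]] m.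
Context d (Omega : measurableType d) (P : probability Omega R).
Variable eta : nat -> Omega -> W.
Hypothesis meta : forall n, measurable_fun setT (eta n).
Hypothesis eta_law : forall n E, measurable E -> P (eta n @^-1` E) = mu E.
Hypothesis eta_indep : mutually_independent P eta.
Variables (x : nat -> V) (K : pred nat).
Hypothesis Kinf : forall N, exists2 n, (N <= n)%N & K n.
Hypothesis xn0 : forall n, K n -> x n != 0.
Hypothesis xsum : (\sum_(0 <= n <oo | K n) `|x n|%:E < +oo)%E.
Hypothesis Xsum :
  (\sum_(0 <= n <oo | K n) \int[mu]_y (minr `|X t (x n) y| 1)%:E < +oo)%E.

Definition partial_sum (y : nat -> W) n : V := \sum_(i < n | K i) X t (x i) (y i).

Definition transformed_sum (y : nat -> W) : V := lim (partial_sum y n @[n --> \oo]).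

Let measurable_partial_sum n :
  measurable_fun setT (fun y : family_space nat W => partial_sum y n).
Proof.
apply/measurable_fun_rVP => i.
pose F (j : 'I_n) (y : family_space nat W) : R :=
  if K j then X t (x j) (y j) ord0 i else 0.
have FE y : partial_sum y n ord0 i = \sum_(j < n) F j y.
  by rewrite /partial_sum summxE [LHS]big_mkcond.
apply: (eq_measurable_fun (fun y => \sum_(j < n) F j y)).
  by move=> y _; rewrite FE.
apply: measurable_sum => j; rewrite /F; case: (K j) => //.
apply: (measurableT_comp (measurable_rV_coord i)).
apply: (measurableT_comp (X_measurable (x j))).
exact: measurable_eval.
Qed.

Let measurable_limit : measurable_fun setT (transformed_sum : family_space nat W -> V).
Proof. exact: (@measurable_lim_rV _ (family_space nat W)). Qed.

Let measurable_converges :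
  measurable [set w | cvg (partial_sum (eta ^~ w) n @[n --> \oo])].
Proof.
apply: measurable_cvg_set => n.
exact: (measurableT_comp (measurable_partial_sum n) (measurable_family meta)).
Qed.

Let ae_converges : P [set w | ~ cvg (partial_sum (eta ^~ w) n @[n --> \oo])] = 0%E.
Proof.
pose f n w : \bar R := if K n then (minr `|X t (x n) (eta n w)| 1)%:E else 0%E.
have mfn n : measurable_fun setT (fun y => (minr `|X t (x n) y| 1)%:E).
  apply/measurable_EFinP; apply: measurable_minr => //.
  exact: measurable_fun_norm_rV.
have fn0 n y : (0 <= (minr `|X t (x n) y| 1)%:E)%E.
  by rewrite lee_fin le_min normr_ge0 ler01.
have mf n : measurable_fun setT (f n).
  by rewrite /f; case: (K n) => //; exact: (measurableT_comp (mfn n) (meta n)).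
have f0 n w : (0 <= f n w)%E by rewrite /f; case: ifP.
have intf : (\int[P]_w (\sum_(0 <= n <oo) f n w) < +oo)%E.
  rewrite integral_nneseries//; apply: le_lt_trans Xsum.
  rewrite [leRHS]eseries_mkcond; apply: lee_nneseries => [n _ _|n _].
    exact: integral_ge0.
  rewrite /f; case: ifP => _; last by rewrite integral0.
  rewrite [leRHS](@eq_measure_integral _ _ _ setT
    (measure_function_pushforward__canonical__measure_function_Measure P (meta n))).
    by rewrite ge0_integral_pushforward.
  by move=> C mC _; exact/esym/eta_law.
apply: measure_negligible; first exact: (measurableC measurable_converges).
have mS : measurable_fun setT (fun w => \sum_(0 <= n <oo) f n w)%E.
  exact: ge0_emeasurable_sum.
have S0 w : (0 <= \sum_(0 <= n <oo) f n w)%E by exact: nneseries_ge0.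
have := ae_finite_of_integral mS S0 intf.
apply: negligibleS => w /= nc h; apply: nc.
pose u n := if K n then X t (x n) (eta n w) else 0.
have cu : cvgn (series u).
  apply: summable_min1_cvg.
  rewrite (_ : (\sum_(0 <= n <oo) _)%E = (\sum_(0 <= n <oo) f n w)%E)//.
  by apply: eq_eseriesr => n _; rewrite /f /u; case: ifP => // _; rewrite normr0 min_l ?ler01.
suff -> : partial_sum (eta ^~ w) = series u by [].
by apply/funext => n; rewrite /partial_sum /series/= big_mkcond/= big_mkord.
Qed.

Let shift Q (Q_gt0 : (0 < Q)%N) := @wiener_shift R k t Q t_gt0 Q_gt0.

Let wiener_shift0 Q (Q_gt0 : (0 < Q)%N) y : shift Q_gt0 y 0 = y.
Proof.
apply: eq_sig_hprop; first by move=> ? ?; exact: Prop_irrelevance.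
by apply/funext => u /=; rewrite scaler0 addr0.
Qed.

Let sum_change (a b : nat -> V) N n : (N <= n)%N ->
  (forall i, (N <= i)%N -> a i = b i) ->
  \sum_(i < n | K i) b i + (\sum_(i < N | K i) a i - \sum_(i < N | K i) b i) =
  \sum_(i < n | K i) a i.
Proof.
move=> Nn ab.
have natE (c : nat -> V) M :
    \sum_(i < M | K i) c i = \sum_(0 <= i < M) if K i then c i else 0.
  by rewrite big_mkcond big_mkord.
rewrite !natE [X in X + _](big_cat_nat (n := N))//= [RHS](big_cat_nat (n := N))//=.
rewrite addrAC [X in X + _]addrC subrK; congr (_ + _).
by apply: eq_big_nat => i /andP[Ni _]; rewrite ab.
Qed.

(** Shifting mark [n] by [h *m w n] moves the sum of the transformed jumps by
    exactly [h], up to an error that is Lipschitz in [h] with a constant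
    proportional to the length of the final interval. On a short enough interval
    this constant is at most 1/2, whence the expansion. *)
Let expanding_shift : exists N (w : nat -> 'M[R]_(m, k)) Q (Q_gt0 : (0 < Q)%N),
  (forall n, (N <= n)%N -> w n = 0) /\
  forall y, cvg (partial_sum y n @[n --> \oo]) -> forall h h' : V,
    2^-1 * `|h - h'| <=
    `|transformed_sum (fun n => shift Q_gt0 (y n) (h *m w n)) -
      transformed_sum (fun n => shift Q_gt0 (y n) (h' *m w n))|.
Proof.
have [N [w [wN wK wid]]] := spanning_weights Kinf xn0 xsum Hspan.
have /choice[C CP] : forall n, exists C, 0 <= C /\
    forall Q (Q_gt0 : (0 < Q)%N) y v v',
    `|X t (x n) (shift Q_gt0 y v) - X t (x n) (shift Q_gt0 y v')
      - \sum_j (v - v') ord0 j *: A j (x n)| <= C * ramp_len t Q * `|v - v'|.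
  move=> n; have [C C0 CP] := solution_shift X_solution t_gt0 (B_lipschitz (x n)).
  by exists C.
have /choice[D DP] : forall n, exists D, 0 <= D /\
    forall h : V, `|h *m w n| <= D * `|h|.
  move=> n; exists (\sum_i \sum_j `|w n i j|); split.
    by apply: sumr_ge0 => i _; exact: sumr_ge0.
  move=> h; apply: rV_norm_le => [|j].
    by rewrite mulr_ge0//; apply: sumr_ge0 => i _; exact: sumr_ge0.
  rewrite mxE (le_trans (ler_norm_sum _ _ _))// mulr_suml ler_sum// => i _.
  rewrite normrM mulrC ler_pM// ?rV_coord_le_norm//.
  by rewrite (bigD1 j)//= lerDl sumr_ge0.
pose S := \sum_(n < N) C n * D n.
have S0 : 0 <= S.
  by apply: sumr_ge0 => n _; rewrite mulr_ge0//; [have [] := CP n|have [] := DP n].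
(* The error has Lipschitz constant at most [S * t / Q]. *)
pose Q := (truncn (2 * S * t)).+1.
have Q_gt0 : (0 < Q)%N by [].
have SQ : S * ramp_len t Q <= 2^-1.
  rewrite /ramp_len mulrA ler_pdivrMr ?ltr0n//.
  have : 2 * S * t <= Q%:R by rewrite ltW// truncnS_gt.
  lra.
exists N, w, Q, Q_gt0; split=> // y cy h h'.
pose G (h : V) : V := \sum_(n < N | K n) X t (x n) (shift Q_gt0 (y n) (h *m w n)).
have limE h0 : transformed_sum (fun n => shift Q_gt0 (y n) (h0 *m w n)) =
    transformed_sum y + (G h0 - partial_sum y N).
  apply/cvg_lim => //.
  have : partial_sum y n + (G h0 - partial_sum y N) @[n --> \oo] -->
      transformed_sum y + (G h0 - partial_sum y N).
    by apply: cvgD; [exact: cy|exact: cvg_cst].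
  apply: cvg_trans; apply: near_eq_cvg; exists N => // n /= Nn.
  rewrite /partial_sum /G.
  rewrite (@sum_change (fun i => X t (x i) (shift Q_gt0 (y i) (h0 *m w i)))
    (fun i => X t (x i) (y i)))// => i Ni.
  by rewrite wN// mulmx0 wiener_shift0.
rewrite !limE opprD addrACA subrr add0r opprB addrA subrK.
have GP : `|G h - G h' - (h - h')| <= 2^-1 * `|h - h'|.
  have hE : h - h' = \sum_(n < N | K n)
      \sum_j ((h *m w n) - (h' *m w n)) ord0 j *: A j (x n).
    rewrite -[LHS]wid [RHS]big_mkcond/=; apply: eq_bigr => n _.
    rewrite mulmxBl; case: ifPn => // /wK ->.
    by rewrite !mulmx0 subrr big1// => j _; rewrite mxE scale0r.
  rewrite [X in `|_ - X| <= _]hE /G -!sumrB (le_trans (ler_norm_sum _ _ _))//.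
  apply: (@le_trans _ _ (\sum_(n < N | K n) C n * D n * ramp_len t Q * `|h - h'|)).
    apply: ler_sum => n _; have [Cn0 Cn] := CP n; have [Dn0 Dn] := DP n.
    rewrite (le_trans (Cn _ _ _ _ _))// -mulmxBl.
    rewrite [leRHS](_ : _ = C n * ramp_len t Q * (D n * `|h - h'|)); last by ring.
    by rewrite ler_wpM2l// mulr_ge0// ltW// ramp_len_gt0.
  rewrite -mulr_suml ler_wpM2r// -mulr_suml (le_trans _ SQ)//.
  apply: ler_wpM2r; first exact/ltW/ramp_len_gt0.
  rewrite /S big_mkcond/=.
  apply: ler_sum => n _; case: ifP => // _.
  by rewrite mulr_ge0//; [have [] := CP n|have [] := DP n].
have := lerB_dist (h - h') (G h - G h').
rewrite distrC => /le_trans/(_ GP); lra.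
Qed.

(** For almost every mark sequence, almost no [h] sends the shifted sum into [E];
    by Fubini some deterministic [h] does so with probability 0, and the shift
    by this [h] has not changed the null sets. *)
Lemma fixed_points_null (E : set V) : measurable E -> lebesgue_rV E = 0%E ->
  P [set w | E (transformed_sum (eta ^~ w))] = 0%E.
Proof.
move=> mE E0.
have [N [w [Q [Q_gt0 [wN expand]]]]] := expanding_shift.
pose leb : {sigma_finite_measure set V -> \bar R} := @lebesgue_rV R m.
pose shifted (p : Omega * V) : family_space nat W :=
  fun n => shift Q_gt0 (eta n p.1) (p.2 *m w n).
have mshifted : measurable_fun setT shifted.
  apply: measurable_family => n; apply: measurable_to_wiener => u.
  apply/measurable_fun_rVP => j.
  rewrite [X in measurable_fun _ X](_ : _ = (fun p : Omega * V =>
      path_at u (eta n p.1) ord0 j + ramp t Q u * \sum_i p.2 ord0 i * w n i j)).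
    apply: measurable_funD.
      apply: (measurableT_comp (measurable_path_coord u j)).
      exact: (measurableT_comp (meta n) measurable_fst).
    apply: measurable_funM => //; apply: measurable_sum => i.
    apply: measurable_funM => //.
    exact: (measurableT_comp (measurable_rV_coord i) measurable_snd).
  by apply/funext => p; rewrite /= !mxE.
pose S : set (Omega * V) := [set p | E (transformed_sum (shifted p))].
have mS : measurable S.
  rewrite -[X in measurable X]setTI.
  exact: (measurableT_comp measurable_limit mshifted).
have PlebS : (\int[P]_o leb (xsection S o) = 0)%E.
  rewrite -[RHS](integral0 P setT); apply: ge0_ae_eq_integral => //.
    exact: measurable_fun_xsection.
  exists [set o | ~ cvg (partial_sum (eta ^~ o) n @[n --> \oo])].
  split=> //; first exact: (measurableC measurable_converges).
  move=> o /= ho co; apply: ho => _.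
  have f2 : (0 : R) < 2^-1 by rewrite invr_gt0.
  have mf : measurable_fun setT (fun h => transformed_sum (shifted (o, h))).
    exact: (measurableT_comp measurable_limit (measurableT_comp mshifted (pair1_measurable o))).
  have := expanding_null f2 mf (expand _ co) mE E0.
  by rewrite /leb/= xsectionE.
have lebPS : (\int[leb]_h P (ysection S h) = 0)%E.
  rewrite -PlebS; apply/esym.
  apply: (@product_measure_unique _ _ _ _ _ P leb (P \x^ leb)%E) => // F G mF mG.
  by rewrite /= product_measure2E.
have [h Ph] : exists h, P (ysection S h) = 0%E.
  apply: contrapT => nex.
  have mP : measurable_fun setT (fun h => P (ysection S h)).
    exact: measurable_fun_ysection.
  have : (\int[leb]_h `|P (ysection S h)| = 0)%E.
    by rewrite -lebPS; apply: eq_integral => h _; rewrite gee0_abs.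
  move/(ae_eq_integral_abs leb measurableT mP) => ae0.
  have : leb setT = 0%E.
    apply: measure_negligible => //; apply: negligibleS ae0 => h _ /= hh.
    by apply: nex; exists h; exact: hh.
  have : (leb (@dyadic_cube R m 0 [ffun=> 0%R]) <= leb setT)%E.
    by apply: le_measure; rewrite ?inE//; exact: measurable_dyadic_cube.
  have -> : leb (@dyadic_cube R m 0 [ffun=> 0%R]) = 1%E.
    apply: (etrans (lebesgue_dyadic_cube 0 _)).
    by rewrite expr0 invr1 expr1n.
  by move=> + l0; rewrite l0 lee_fin ler10.
pose F : set (family_space nat W) := (transformed_sum : family_space nat W -> V) @^-1` E.
rewrite -[LHS]/(P [set o | F (fun n => eta n o)]).
apply: (@marks_shift_null R k t Q t_gt0 Q_gt0 mu mu_wiener _ _ P eta meta eta_law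
  eta_indep (fun n => h *m w n) N F).
- by move=> n /wN ->; rewrite mulmx0.
- by rewrite -[X in measurable X]setTI; exact: measurable_limit.
- rewrite -[RHS]Ph; congr (P _); apply/seteqP; split=> o /=.
    by move=> ?; apply/ysectionP.
  by move/ysectionP.
Qed.

End fixed_points.

(** * Poisson jumps *)

Section poisson_mean.
Context {R : realType}.
Local Open Scope ereal_scope.

Definition poisson_weight (l : R) n : R := (l ^+ n / n`!%:R * expR (- l))%R.

Let poisson_weight_ge0 l n : (0 <= l)%R -> (0 <= poisson_weight l n)%R.
Proof. by move=> l0; rewrite mulr_ge0 ?expR_ge0// divr_ge0 ?exprn_ge0. Qed.

Lemma poisson_total (l : R) : (0 <= l)%R ->
  \sum_(0 <= n <oo) (poisson_weight l n)%:E = 1.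
Proof.
move=> l0; rewrite [RHS](_ : _ = (expR (- l))%:E * (expR l)%:E); last first.
  by rewrite -EFinM expRN mulVf ?gt_eqF ?expR_gt0.
under eq_eseriesr do rewrite /poisson_weight EFinM muleC.
rewrite /= nneseriesZl/=; last by move=> n _; rewrite lee_fin divr_ge0// exprn_ge0.
congr *%E; rewrite expRE -EFin_lim; last first.
  rewrite /pseries/=; under eq_fun do rewrite mulrC.
  exact: is_cvg_series_exp_coeff.
apply/congr_lim/funext => n/=; rewrite /pseries/= /series/= -sumEFin//.
by under eq_bigr do rewrite mulrC.
Qed.

Lemma poisson_mean (l : R) : (0 <= l)%R ->
  \sum_(0 <= n <oo) (n%:R * poisson_weight l n)%:E = l%:E.
Proof.
move=> l0.
rewrite nneseries_recl//; last first.
  by move=> n _; rewrite lee_fin mulr_ge0// poisson_weight_ge0.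
rewrite mul0r add0e.
transitivity (\sum_(0 <= n <oo) l%:E * (poisson_weight l n)%:E).
  rewrite -(@nneseries_addn _ (fun n => (n%:R * poisson_weight l n)%:E) 1); last first.
    by move=> n; rewrite lee_fin mulr_ge0// poisson_weight_ge0.
  apply: eq_eseriesr => n _; rewrite addn1 -EFinM; congr EFin.
  rewrite /poisson_weight factS natrM exprS.
  by field; rewrite pnatr_eq0 -lt0n fact_gt0 addrC natr1 pnatr_eq0.
rewrite nneseriesZl ?poisson_total ?mule1// => n _.
by rewrite lee_fin poisson_weight_ge0.
Qed.

End poisson_mean.

Section poisson_expectation.
Context d (Omega : measurableType d) d' (T : measurableType d') {R : realType}.
Variables (P : probability Omega R) (M : Omega -> {measure set T -> \bar R}).
Variable Lambda : set T -> \bar R.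
Hypothesis M_poisson : poisson_random_measure P M Lambda.
Local Open Scope ereal_scope.

(** The mean of the Poisson law: [M w E] is almost surely a natural number, as
    the Poisson weights sum to 1. *)
Lemma poisson_expectation E : measurable E -> 0 <= Lambda E -> Lambda E < +oo ->
  \int[P]_w M w E = Lambda E.
Proof.
move=> mE L0 Loo; have [mM law _ _] := M_poisson.
pose l := fine (Lambda E).
have l0 : (0 <= l)%R by exact: fine_ge0.
pose V n := [set w | M w E = n%:R%:E].
have mV n : measurable (V n).
  by rewrite -[X in measurable X]setTI; apply: (mM E mE measurableT [set n%:R%:E]).
have tV : trivIset setT V.
  move=> i j _ _ [w [/= hi]]; rewrite /V/= hi => -[] /eqP.
  by rewrite eqr_nat => /eqP.
have PV n : P (V n) = (poisson_weight l n)%:E by exact: law.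
have aeV : P.-negligible (~` \bigcup_n V n).
  exists (~` \bigcup_n V n); split=> //.
    by apply: measurableC; exact: bigcupT_measurable.
  rewrite probability_setC; last exact: bigcupT_measurable.
  rewrite [X in 1 - X](_ : _ = 1) ?subee//.
  rewrite measure_bigcup// -(poisson_total l0) [LHS]eseries_mkcond.
  by apply: eq_eseriesr => n _; rewrite in_setT -PV.
transitivity (\int[P]_w \sum_(0 <= n <oo) (n%:R * \1_(V n) w)%:E).
  apply: ge0_ae_eq_integral => //.
  - exact: mM.
  - apply: ge0_emeasurable_sum => [n w _ _|n _].
      by rewrite lee_fin mulr_ge0.
    by apply/measurable_EFinP; apply: measurable_funM => //; exact: measurable_indic.
  - by move=> w _; apply: nneseries_ge0 => n _ _; rewrite lee_fin mulr_ge0.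
  apply: negligibleS aeV => w /= nh [n _ Vn]; apply: nh => _.
  rewrite (_ : M w E = n%:R%:E)//.
  rewrite (@nneseriesD1 _ _ n)//.
  rewrite eseries0 ?adde0.
    by rewrite indicE mem_set// mulr1.
  move=> i _ /= ni; rewrite indicE memNset ?mulr0// => Vi.
  by move/eqP: ni; apply; apply: (tV i n) => //; exists w.
rewrite integral_nneseries//; last first.
  by move=> n; apply/measurable_EFinP; apply: measurable_funM => //; exact: measurable_indic.
under eq_eseriesr => n _.
  under eq_integral do rewrite EFinM.
  rewrite (_ : \int[P]_w _ = n%:R%:E * \int[P]_w (\1_(V n) w)%:E); last first.
    by apply: ge0_integralZl => //; apply/measurable_EFinP; exact: measurable_indic.
  rewrite integral_indic// setIT [X in _ * X](_ : _ = (poisson_weight l n)%:E);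
    last exact: PV.
  rewrite -EFinM.
  over.
by rewrite poisson_mean// /l fineK// ge0_fin_numE.
Qed.

End poisson_expectation.

Section jumps.
Context {R : realType} {m : nat}.
Local Notation V := 'rV[R]_m.
Context d (Omega : measurableType d) (P : probability Omega R).
Variables (nu : {measure set V -> \bar R}).
Variables (sigma : nat -> Omega -> R) (xi : nat -> Omega -> V).
Hypothesis sigma_measurable : forall n, measurable_fun setT (sigma n).
Hypothesis xi_measurable : forall n, measurable_fun setT (xi n).
Hypothesis M_poisson : poisson_random_measure P
  (fun w => point_measure (sigma ^~ w) (xi ^~ w)) (jump_intensity nu).
Variables (s : R) (s_gt0 : 0 < s).
Local Open Scope ereal_scope.

Let window (C : set V) : set (measurableTypeR R * V) := `]-oo, s]%classic `*` C.

Let intensity_window C : measurable C -> jump_intensity nu (window C) = s%:E * nu C.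
Proof.
move=> mC; rewrite /jump_intensity /product_measure1.
pose I : set (measurableTypeR R) := `]-oo, s]%classic.
have mI : measurable I by exact: measurable_itv.
rewrite (eq_integral (fun u => nu C * (\1_I u)%:E)); last first.
  move=> u _; rewrite /= /window.
  have [uI|uI] := boolP (u \in I).
    by rewrite in_xsectionX// indicE uI mule1.
  by rewrite notin_xsectionX// measure0 indicE (negbTE uI) mule0.
rewrite ge0_integralZl//; last by apply/measurable_EFinP; exact: measurable_indic.
rewrite integral_indic// setIT muleC; congr (_ * _).
rewrite /= /mrestr (_ : _ `&` _ = `[0%R, s]%classic).
  by rewrite lebesgue_measure_itv/= lte_fin s_gt0 sube0.
apply/seteqP; split=> u /=; rewrite /I/= !in_itv/= andbT => h; first by rewrite andbC; apply/andP.
by case/andP: h.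
Qed.

Let measurable_window C : measurable C -> measurable (window C).
Proof. by move=> mC; apply: measurableX => //; exact: measurable_itv. Qed.

Let pick n w : R := (sigma n w <= s)%R%:R.

Let measurable_pick n : measurable_fun setT (pick n).
Proof.
have -> : pick n = \1_(`]-oo, s]%classic : set R) \o sigma n.
  apply/funext => w; rewrite /pick/= indicE; congr (_ %:R).
  by rewrite mem_setE in_itv.
exact: (measurableT_comp (measurable_indic (measurable_itv _)) (sigma_measurable n)).
Qed.

Let pick_ge0 n w : (0 <= pick n w)%R.
Proof. by []. Qed.

Let point_measure_window C w : point_measure (sigma ^~ w) (xi ^~ w) (window C) =
  \sum_(0 <= n <oo) (pick n w * \1_C (xi n w))%:E.
Proof.
apply: eq_eseriesr => n _; rewrite /= diracE /window /pick indicE -natrM mulnb.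
congr (_%:R%:E); congr nat_of_bool; rewrite in_setX/=; congr (_ && _).
by rewrite mem_setE in_itv.
Qed.

(** Half of Campbell's formula. The mean number of jumps in [C] before time [s]
    is [s%:E * nu C] when this is finite; when it is infinite the upper bound is
    trivial. *)
Lemma campbell_le (F : V -> \bar R) : measurable_fun setT F -> (forall x, 0 <= F x) ->
  \int[P]_w (\sum_(0 <= n <oo | (sigma n w <= s)%R) F (xi n w)) <=
  s%:E * \int[nu]_x F x.
Proof.
move=> mF F0.
have /choice[mm mmP] : forall n, exists mn : {measure set V -> \bar R},
    (forall E, measurable E -> mn E = \int[P]_w (pick n w * \1_E (xi n w))%:E) /\
    forall f, measurable_fun setT f -> (forall y, 0 <= f y) ->
      \int[mn]_y f y = \int[P]_w ((pick n w)%:E * f (xi n w)).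
  move=> n; exact: (weighting_measure P (xi_measurable n) (measurable_pick n) (@pick_ge0 n)).
have mFn n : measurable_fun setT (fun w => (pick n w)%:E * F (xi n w)).
  apply: emeasurable_funM; first exact/measurable_EFinP.
  exact: (measurableT_comp mF (xi_measurable n)).
have Fn0 n w : 0 <= (pick n w)%:E * F (xi n w) by apply: mule_ge0; rewrite ?lee_fin.
rewrite (eq_integral (fun w => \sum_(0 <= n <oo) ((pick n w)%:E * F (xi n w)))); last first.
  move=> w _; rewrite eseries_mkcond; apply: eq_eseriesr => n _.
  by rewrite /pick; case: ifP => _; rewrite ?mul1e ?mul0e.
rewrite integral_nneseries//.
rewrite (eq_eseriesr (g := fun n => \int[mm n]_y F y)); last first.
  by move=> n _; have [_ e] := mmP n; rewrite e.
rewrite -(ge0_integral_measure_series mm)//.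
rewrite -(@ge0_integral_mscale _ _ _ nu setT _ (NngNum (ltW s_gt0)))//.
apply: ge0_le_measure_integral => // C mC.
rewrite /= /mscale/= /mseries.
rewrite (eq_eseriesr (g := fun n => \int[P]_w (pick n w * \1_C (xi n w))%:E)); last first.
  by move=> n _; have [e _] := mmP n; rewrite e.
rewrite -integral_nneseries//; last 2 first.
- move=> n; apply/measurable_EFinP; apply: measurable_funM => //.
  exact: (measurableT_comp (measurable_indic mC) (xi_measurable n)).
- by move=> n w _; rewrite lee_fin mulr_ge0.
rewrite (eq_integral (fun w => point_measure (sigma ^~ w) (xi ^~ w) (window C))); last first.
  by move=> w _; rewrite point_measure_window.
have [nuC|] := ltP (nu C) +oo.
  rewrite (poisson_expectation M_poisson) ?intensity_window//.
  - exact: measurable_window.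
  - by rewrite mule_ge0// lee_fin ltW.
  - by rewrite lte_mul_pinfty// lee_fin ltW.
rewrite leye_eq => /eqP ->; rewrite gt0_muley ?leey// lte_fin.
Qed.

(** The jumps before time [s] are counted by a variable of infinite intensity. *)
Lemma ae_infinitely_many : nu setT = +oo ->
  {ae P, forall w, forall N, exists2 n, (N <= n)%N & (sigma n w <= s)%R}.
Proof.
move=> nuoo; have [mM _ Moo _] := M_poisson.
have mW := measurable_window measurableT.
have Loo : jump_intensity nu (window setT) = +oo.
  by rewrite intensity_window// nuoo gt0_muley// lte_fin.
have P1 := Moo _ mW Loo.
have mE : measurable [set w | point_measure (sigma ^~ w) (xi ^~ w) (window setT) = +oo].
  by rewrite -[X in measurable X]setTI; apply: (mM _ mW measurableT [set +oo]).
exists (~` [set w | point_measure (sigma ^~ w) (xi ^~ w) (window setT) = +oo]).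
split; first exact: measurableC.
  by rewrite probability_setC// P1 subee.
move=> w /= h hoo; apply: h => N; apply: contrapT => nex.
move: hoo; rewrite point_measure_window.
rewrite (nneseries_split 0 N)//; last by move=> n _; rewrite lee_fin mulr_ge0.
rewrite eseries0 ?adde0.
  by rewrite add0n sumEFin.
move=> n Nn _; rewrite /pick.
have [h|_] := boolP (sigma n w <= s)%R; last by rewrite mul0r.
by exfalso; apply: nex; exists n => //; rewrite add0n in Nn.
Qed.

End jumps.

Section transported.
Context {R : realType} {m k : nat}.
Local Notation V := 'rV[R]_m.
Local Notation W := (wiener_space R k).
Variables (mu : probability W R) (X : R -> V -> W -> V) (t : R).
Hypothesis X_measurable : measurable_fun setT (fun p : V * W => X t p.1 p.2).

Lemma measurable_solution_at x : measurable_fun setT (X t x).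
Proof. exact: (measurableT_comp X_measurable (pair1_measurable x)). Qed.

Lemma integral_transported (nu : {measure set V -> \bar R}) (f : V -> \bar R) :
  measurable_fun setT f -> (forall x, (0 <= f x)%E) ->
  (\int[transported_measure nu mu X t]_z f z =
   \int[nu]_x \int[mu]_y f (X t x y))%E.
Proof.
move=> mf f0.
pose kap x : {measure set V -> \bar R} :=
  measure_function_pushforward__canonical__measure_function_Measure mu
    (measurable_solution_at x).
have mkap E : measurable E -> measurable_fun setT (kap ^~ E).
  move=> mE; pose S := (fun p : V * W => X t p.1 p.2) @^-1` E.
  have mS : measurable S by rewrite -[X in measurable X]setTI; exact: X_measurable.
  have := measurable_fun_xsection mu mS.
  apply: eq_measurable_fun => x _; rewrite /= /pushforward; congr (mu _).
  by apply/seteqP; split=> y; rewrite xsectionE.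
rewrite -[LHS]/(\int[mixture nu mkap]_z f z)%E integral_mixture//.
apply: eq_integral => x _; rewrite ge0_integral_pushforward//.
exact: measurable_solution_at.
Qed.

Lemma measurable_mark_expectation (f : V -> \bar R) : measurable_fun setT f ->
  (forall x, (0 <= f x)%E) ->
  measurable_fun setT (fun x => \int[mu]_y f (X t x y))%E.
Proof.
move=> mf f0.
apply: (@measurable_fun_fubini_tonelli_F _ _ V W R mu (fun p => f (X t p.1 p.2))) => //.
exact: (measurableT_comp mf X_measurable).
Qed.

End transported.

(** * Absolute continuity of the transform *)

Section distribution_measure.
Context d (Omega : measurableType d) (R : realType) (P : probability Omega R).

Lemma law_probability d' (T : measurableType d') (f : Omega -> T) :
  measurable_fun setT f -> exists Q : probability T R,
    (Q : set T -> \bar R) = pushforward P f.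
Proof.
move=> mf; pose f' : {mfun Omega >-> T} := HB.pack f (isMeasurableFun.Build _ _ _ _ f mf).
by exists (distribution P f').
Qed.

(** Under independence the joint law is the product of the marginal laws, so
    that one of the two variables may be frozen. *)
Lemma independent_sections d1 (S1 : measurableType d1) d2 (S2 : measurableType d2)
    (f : Omega -> S1) (g : Omega -> S2) :
  measurable_fun setT f -> measurable_fun setT g ->
  (forall A B, measurable A -> measurable B ->
    P (f @^-1` A `&` g @^-1` B) = (P (f @^-1` A) * P (g @^-1` B))%E) ->
  forall S, measurable S ->
  P [set w | S (f w, g w)] = (\int[P]_w P [set w' | S (f w, g w')])%E.
Proof.
move=> mf mg fg S mS.
have [P1 P1E] := law_probability mf.
have [P2 P2E] := law_probability mg.
have mfg : measurable_fun setT (fun w => (f w, g w)).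
  exact: measurable_fun_pair.
have [Pfg PfgE] := law_probability mfg.
have e : ((P1 \x P2) S = Pfg S)%E.
  apply: product_measure_unique => // A B mA mB.
  have e1 : P1 A = P (f @^-1` A) by rewrite P1E.
  have e2 : P2 B = P (g @^-1` B) by rewrite P2E.
  rewrite [RHS](congr2 mule e1 e2) -fg//.
  by rewrite -[LHS]/(Pfg (A `*` B)) PfgE.
rewrite PfgE in e.
rewrite -[LHS]e /product_measure1.
have mP2 : measurable_fun setT (P2 \o xsection S)%E by exact: measurable_fun_xsection.
have P1E' := fun A (_ : measurable A) (_ : A `<=` setT) => congr1 (fun h => h A) P1E.
rewrite (@eq_measure_integral _ _ _ setT
    (measure_function_pushforward__canonical__measure_function_Measure P mf) P1 _ P1E').
rewrite ge0_integral_pushforward//.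
apply: eq_integral => w _; rewrite /= P2E /pushforward; congr (P _).
by apply/seteqP; split=> w'; rewrite /= xsectionE.
Qed.

End distribution_measure.

Lemma measurable_jump_transform (R : realType) (m k : nat)
    (X : R -> 'rV[R]_m -> wiener_space R k -> 'rV[R]_m) (t s : R)
    (X_measurable : measurable_fun setT
       (fun p : 'rV[R]_m * wiener_space R k => X t p.1 p.2))
    d (D : measurableType d) (sg : nat -> D -> R) (xx : nat -> D -> 'rV[R]_m)
    (yy : nat -> D -> wiener_space R k) :
  (forall n, measurable_fun setT (sg n)) ->
  (forall n, measurable_fun setT (xx n)) ->
  (forall n, measurable_fun setT (yy n)) ->
  measurable_fun setT (jump_transform X sg xx yy t s).
Proof.
move=> msg mxx myy.
apply: (@measurable_lim_rV _ D R m (fun n w => jump_partial_sum (sg ^~ w)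
  (fun n => X t (xx n w) (yy n w)) s n)) => n.
apply/measurable_fun_rVP => i.
pose F (j : 'I_n) (w : D) : R :=
  if sg j w <= s then X t (xx j w) (yy j w) ord0 i else 0.
apply: (eq_measurable_fun (fun w => \sum_(j < n) F j w)).
  by move=> w _; rewrite /jump_partial_sum summxE [RHS]big_mkcond.
apply: measurable_sum => j; apply: measurable_fun_ifT => //.
- exact: measurable_fun_ler.
- apply: (measurableT_comp (measurable_rV_coord i)).
  exact: (measurableT_comp X_measurable (measurable_fun_pair (mxx j) (myy j))).
Qed.

Section transform_null.
Context {R : realType} {m k : nat}.
Local Notation V := 'rV[R]_m.
Local Notation W := (wiener_space R k).
Variables (nu : {measure set V -> \bar R}).
Variables (mu : probability W R) (mu_wiener : wiener_measure mu).
Variables (A : 'I_k -> V -> V) (B : V -> V -> V) (X : R -> V -> W -> V).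
Hypothesis B_lipschitz : forall x, [lipschitz B z x | z in setT].
Hypothesis X_solution : solution A B X.
Variables (t s : R) (t_gt0 : 0 < t) (s_gt0 : 0 < s).
Hypothesis X_measurable : measurable_fun setT (fun p : V * W => X t p.1 p.2).
Hypothesis nuPi_summable :
  (\int[transported_measure nu mu X t]_x (Num.min `|x| 1)%:E < +oo)%E.
Hypothesis Hspan : forall x : nat -> V, (forall n, x n != 0) ->
  x @ \oo --> (0 : V) ->
  span_has_dim [set A p.2 (x p.1) | p in [set: nat * 'I_k]] m.
Hypothesis nu_infinite : nu setT = +oo%E.
Context d (Omega : measurableType d) (P : probability Omega R).
Variables (sigma : nat -> Omega -> R) (xi : nat -> Omega -> V).
Variable eta : nat -> Omega -> W.
Hypothesis sigma_measurable : forall n, measurable_fun setT (sigma n).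
Hypothesis xi_measurable : forall n, measurable_fun setT (xi n).
Hypothesis xi_neq0 : {ae P, forall w n, xi n w != 0}.
Hypothesis xi_summable :
  {ae P, forall w, (\sum_(0 <= n <oo | (sigma n w <= s)%R) `|xi n w|%:E < +oo)%E}.
Hypothesis M_poisson : poisson_random_measure P
  (fun w => point_measure (sigma ^~ w) (xi ^~ w)) (jump_intensity nu).
Hypothesis eta_marks : iid_marks P mu sigma xi eta.

Let F (x : V) : \bar R := (\int[mu]_y (minr `|X t x y| 1)%:E)%E.

Let min1_ge0 (x : V) : (0 <= (minr `|x| 1)%:E :> \bar R)%E.
Proof. by rewrite lee_fin le_min normr_ge0 ler01. Qed.

Let measurable_min1 : measurable_fun setT (fun x : V => (minr `|x| 1)%:E).
Proof.
apply/measurable_EFinP; apply: measurable_minr => //.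
exact: measurable_fun_norm_rV.
Qed.

Let mF : measurable_fun setT F.
Proof. exact: (measurable_mark_expectation mu X_measurable measurable_min1 min1_ge0). Qed.

Let F_ge0 x : (0 <= F x)%E.
Proof. exact: integral_ge0. Qed.

Let F_summable :
  {ae P, forall w, (\sum_(0 <= n <oo | (sigma n w <= s)%R) F (xi n w) < +oo)%E}.
Proof.
apply: ae_finite_of_integral.
- rewrite (_ : (fun w => _) = (fun w =>
    \sum_(0 <= n <oo) if (sigma n w <= s)%R then F (xi n w) else 0)%E); last first.
    by apply/funext => w; rewrite eseries_mkcond.
  apply: ge0_emeasurable_sum => [n w _ _|n _]; first by case: ifP.
  apply: measurable_fun_ifT => //; first exact: measurable_fun_ler.
  exact: (measurableT_comp mF (xi_measurable n)).
- by move=> w; apply: nneseries_ge0.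
- apply: le_lt_trans (campbell_le sigma_measurable xi_measurable M_poisson s_gt0 mF F_ge0) _.
  rewrite lte_mul_pinfty// ?lee_fin ?(ltW s_gt0)//.
  by rewrite -(integral_transported mu X_measurable nu measurable_min1 min1_ge0).
Qed.

(** Points and marks are independent, so that the points may be frozen. Almost
    surely there are infinitely many of them before time [s], they are nonzero
    and summable, and so are the truncated means of their transforms: each frozen
    configuration satisfies the assumptions of [fixed_points_null]. *)
Lemma jump_transform_null (E : set V) : measurable E -> lebesgue_rV E = 0%E ->
  P (jump_transform X sigma xi eta t s @^-1` E) = 0%E.
Proof.
move=> mE E0; have [meta eta_law eta_indep eta_points] := eta_marks.
pose points w : family_space nat (R * V)%type := fun n => (sigma n w, xi n w).
pose marks w : family_space nat W := fun n => eta n w.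
have mpoint n : measurable_fun setT (fun w => (sigma n w, xi n w)).
  exact: measurable_fun_pair.
pose FS : measurableType _ := (family_space nat (R * V)%type * family_space nat W)%type.
pose T : FS -> V :=
  jump_transform X (fun n (p : FS) => (p.1 n).1) (fun n (p : FS) => (p.1 n).2)
    (fun n (p : FS) => p.2 n) t s.
have mT : measurable_fun setT T.
  apply: measurable_jump_transform => // n.
  - apply: (measurableT_comp measurable_fst).
    exact: (measurableT_comp (measurable_eval n) measurable_fst).
  - apply: (measurableT_comp measurable_snd).
    exact: (measurableT_comp (measurable_eval n) measurable_fst).
  - exact: (measurableT_comp (measurable_eval n) measurable_snd).
have mS : measurable (T @^-1` E) by rewrite -[X in measurable X]setTI; exact: mT.
have indep C D : measurable C -> measurable D ->
    P (points @^-1` C `&` marks @^-1` D) =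
    (P (points @^-1` C) * P (marks @^-1` D))%E.
  move=> mC mD; apply: eta_points.
  - pose O1 := g_sigma_algebraType
      (\bigcup_n preimage_set_system setT (fun w => (sigma n w, xi n w)) measurable).
    have h : measurable_fun setT (points : O1 -> _).
      apply: measurable_family => n _ G mG; apply: sub_sigma_algebra.
      by exists n => //; exists G.
    by rewrite -[X in sigma_of _ X]setTI; exact: (h measurableT C mC).
  - pose O2 := g_sigma_algebraType
      (\bigcup_n preimage_set_system setT (eta n) measurable).
    have h : measurable_fun setT (marks : O2 -> _).
      apply: measurable_family => n _ G mG; apply: sub_sigma_algebra.
      by exists n => //; exists G.
    by rewrite -[X in sigma_of _ X]setTI; exact: (h measurableT D mD).
have := independent_sections (measurable_family mpoint) (measurable_family meta) indep mS.
rewrite -[X in P X = _]/(jump_transform X sigma xi eta t s @^-1` E) => ->.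
rewrite -[RHS](integral0 P setT); apply: ge0_ae_eq_integral => //.
  have [Q QE] := law_probability P (measurable_family meta).
  have mQ := measurable_fun_xsection Q mS.
  apply: (eq_measurable_fun (fun w => Q (xsection (T @^-1` E) (points w)))).
    move=> w _; rewrite QE /pushforward; congr (P _).
    by apply/seteqP; split=> w'; rewrite /= xsectionE.
  exact: (measurableT_comp mQ (measurable_family mpoint)).
have inf := ae_infinitely_many M_poisson s_gt0 nu_infinite.
have FP : Filter (nbhs (almost_everywhere P)) by exact: ae_filter_ringOfSetsType.
have := @filterI _ _ FP _ _ (@filterI _ _ FP _ _ xi_neq0 xi_summable)
  (@filterI _ _ FP _ _ inf F_summable).
apply: (@filterS _ _ FP) => w [[w0 wx] [wi wF]] _.
exact: (fixed_points_null mu_wiener B_lipschitz X_solution t_gt0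
  (measurable_solution_at X_measurable) Hspan meta eta_law eta_indep wi
  (fun n _ => w0 n) wx wF mE E0).
Qed.

End transform_null.

(** Radon--Nikodym, with a finite nonnegative version of the density. *)
Lemma density_of_null (R : realType) (m : nat) d (Omega : measurableType d)
    (P : probability Omega R) (T : Omega -> 'rV[R]_m) :
  measurable_fun setT T ->
  (forall E, measurable E -> lebesgue_rV E = 0%E -> P (T @^-1` E) = 0%E) ->
  has_density P T.
Proof.
move=> mT null; split=> //; have [Q QE] := law_probability P mT.
have dom : Q `<< @lebesgue_rV R m.
  by apply/null_content_dominatesP => E mE E0; rewrite QE; exact: null.
have [f [f0 ffin intf fE]] := radon_nikodym_sigma_finite dom.
exists (fine \o f); split.
- by apply: measurableT_comp => //; exact: measurable_int intf.
- by move=> x; exact: fine_ge0.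
- move=> E mE; rewrite -[LHS]/(pushforward P T E) -QE fE//.
  by apply: eq_integral => x _; rewrite /= fineK.
Qed.

Theorem proposition4 (R : realType) (m k : nat)
    (* the Levy measure *)
    (nu : {measure set 'rV[R]_m -> \bar R})
    (nu_levy : levy_measure nu)
    (nu_summable : (\int[nu]_x (Num.min `|x| 1)%:E < +oo)%E)
    (* Wiener space, the coefficients and the solution *)
    (mu : probability (wiener_space R k) R)
    (mu_wiener : wiener_measure mu)
    (A : 'I_k -> 'rV[R]_m -> 'rV[R]_m)
    (B : 'rV[R]_m -> 'rV[R]_m -> 'rV[R]_m)
    (B_C1 : forall x, C1 (fun z => B z x))
    (B_lipschitz : forall x, [lipschitz B z x | z in setT])
    (X : R -> 'rV[R]_m -> wiener_space R k -> 'rV[R]_m)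
    (X_solution : solution A B X)
    (t s : R) (t_gt0 : 0 < t) (s_gt0 : 0 < s)
    (X_measurable : measurable_fun setT
       (fun p : 'rV[R]_m * wiener_space R k => X t p.1 p.2))
    (nuPi_summable :
       (\int[transported_measure nu mu X t]_x (Num.min `|x| 1)%:E < +oo)%E)
    (* the Levy process Z, its jumps xi_n at times sigma_n, and their marks *)
    (dO : measure_display) (Omega : measurableType dO)
    (P : probability Omega R)
    (Z : R -> Omega -> 'rV[R]_m) (Z_levy : levy_process P Z)
    (sigma : nat -> Omega -> R) (xi : nat -> Omega -> 'rV[R]_m)
    (sigma_measurable : forall n, measurable_fun setT (sigma n))
    (xi_measurable : forall n, measurable_fun setT (xi n))
    (Z_jumps : {ae P, forall w,
       enumerates_jumps (Z ^~ w) (sigma ^~ w) (xi ^~ w)})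
    (Z_sum : {ae P, forall w,
       summable_jumps (Z ^~ w) (sigma ^~ w) (xi ^~ w)})
    (M_poisson : poisson_random_measure P
       (fun w => point_measure (sigma ^~ w) (xi ^~ w)) (jump_intensity nu))
    (eta : nat -> Omega -> wiener_space R k)
    (eta_marks : iid_marks P mu sigma xi eta) :
  nu setT = +oo%E ->
  (forall x : nat -> 'rV[R]_m, (forall n, x n != 0) -> x @ \oo --> (0 : 'rV[R]_m) ->
     span_has_dim [set A p.2 (x p.1) | p in [set: nat * 'I_k]] m) ->
  has_density P (jump_transform X sigma xi eta t s).
Proof.
move=> nu_infinite span_hyp.
have [meta _ _ _] := eta_marks.
have FP : Filter (nbhs (almost_everywhere P)) by exact: ae_filter_ringOfSetsType.
have xi_neq0 : {ae P, forall w n, xi n w != 0}.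
  by apply: (@filterS _ _ FP) Z_jumps => w [_ jumps _] n; have [] := jumps n.
have xi_summable : {ae P, forall w,
    (\sum_(0 <= n <oo | (sigma n w <= s)%R) `|xi n w|%:E < +oo)%E}.
  by apply: (@filterS _ _ FP) Z_sum => w /(_ s (ltW s_gt0))[].
apply: density_of_null; first exact: measurable_jump_transform.
move=> E mE E0.
exact: (jump_transform_null mu_wiener B_lipschitz X_solution t_gt0 s_gt0
  X_measurable nuPi_summable span_hyp nu_infinite sigma_measurable xi_measurable
  xi_neq0 xi_summable M_poisson eta_marks mE E0).
Qed.
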